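(* Let $G$ be a group acting by automorphisms on an abelian group $A$, where $G$, $A$ and the action of $G$ on $A$ are $\emptyset$-definable in a first-order structure $\mathcal G$. Let $B\subset\mathcal G$ be a finite parameter set and let $h\colon G\times G\to A$ be a 2-cocycle which is $B$-definable in $\mathcal G$ and has finite image $\mathrm{Im}(h)\subseteq\mathrm{dcl}(B)$. Let $\mathcal G^*\succ\mathcal G$ be a monster model, let $\widetilde{G}$ be the extension of $G$ by $A$ defined by $h$ and $\widetilde{G^*}$ its interpretation in $\mathcal G^*$. Suppose that ${G^*}^{000}_B={G^*}^{00}_B$. Then $\widetilde{G^*}^{00}_B/\widetilde{G^*}^{000}_B$ is isomorphic to $\left(\widetilde{G^*}^{00}_B\cap A^*\right)/\left(\widetilde{G^*}^{000}_B\cap A^*\right)$, and so it is abelian. More precisely, there exists a $B$-invariant isomorphism between these groups.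
   Context: Cocycles. If a group $G$ acts by automorphisms on an abelian group $A$ (written additively), a 2-cocycle is a map $h\colon G\times G\to A$ with $h(g_1,g_2)+h(g_1g_2,g_3)=h(g_1,g_2g_3)+g_1\cdot h(g_2,g_3)$ and $h(g,e)=h(e,g)=0$ for all $g,g_1,g_2,g_3\in G$. It defines the extension $\widetilde G=A\times G$ with product $(a_1,g_1)*(a_2,g_2)=(a_1+g_1\cdot a_2+h(g_1,g_2),\,g_1g_2)$; $A$ is identified with the subgroup $A\times\{e\}$ (and $A^*$ with $A^*\times\{e\}$). Model theory. A monster model $\mathcal G^*\succ\mathcal G$ is a $\kappa$-saturated, strongly $\kappa$-homogeneous elementary extension for a sufficiently large cardinal $\kappa$; ''small'' and ''bounded'' mean of cardinality $<\kappa$. For an object $X$ definable in $\mathcal G$, $X^*$ denotes its interpretation in $\mathcal G^*$. ''$B$-invariant'' means invariant under $\mathrm{Aut}(\mathcal G^*/B)$. For a group $K$ definable over $B$ in $\mathcal G^*$: $K^{00}_B$ is the smallest subgroup of $K$ of bounded index which is type-definable over $B$, and $K^{000}_B$ is the smallest $B$-invariant subgroup of $K$ of bounded index; both are normal in $K$. *)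

(* Defs.v *)
From mathcomp Require Import all_boot.
From mathcomp Require Import boolp classical_sets functions cardinality.
Set Implicit Arguments.
Unset Strict Implicit.
Unset Printing Implicit Defensive.
Local Open Scope classical_set_scope.
Local Open Scope card_scope.

Record language := Language {
  fsymb : Type;
  farity : fsymb -> nat;
  rsymb : Type;
  rarity : rsymb -> nat }.

Inductive term (L : language) (V : Type) : Type :=
  | Var of V
  | App (f : fsymb L) of ('I_(farity f) -> term L V).

(* [V] is the type of free variables; a quantifier binds the variable [None]
   of [option V].  A formula with parameters named by [P] and with free
   variables in [V] is a [formula L (V + P)]. *)
Inductive formula (L : language) (V : Type) : Type :=
  | Fbot
  | Feq of term L V & term L V
  | Frel (r : rsymb L) of ('I_(rarity r) -> term L V)
  | Fimp of formula L V & formula L V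
  | Fall of formula L (option V).

Record structure (L : language) := Structure {
  carrier :> Type;
  finterp : forall f : fsymb L, ('I_(farity f) -> carrier) -> carrier;
  rinterp : forall r : rsymb L, ('I_(rarity r) -> carrier) -> Prop }.

Definition scons (T V : Type) (a : T) (e : V -> T) : option V -> T :=
  fun o => if o is Some v then e v else a.

Definition join (T V W : Type) (e : V -> T) (f : W -> T) : V + W -> T :=
  fun s => match s with inl v => e v | inr w => f w end.

Fixpoint teval (L : language) (N : structure L) (V : Type) (e : V -> N)
    (t : term L V) : N :=
  match t with
  | Var v => e v
  | App f ts => finterp (fun i => teval e (ts i))
  end.

Fixpoint sat (L : language) (N : structure L) (V : Type)
    (phi : formula L V) : (V -> N) -> Prop :=
  match phi with
  | Fbot => fun=> False
  | Feq s t => fun e => teval e s = teval e t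
  | Frel r ts => fun e => rinterp (fun i => teval e (ts i))
  | Fimp phi1 phi2 => fun e => sat phi1 e -> sat phi2 e
  | Fall phi1 => fun e => forall a : N, sat phi1 (scons a e)
  end.

(* the families [e] and [f] have the same type over the empty set *)
Definition same_type (L : language) (M N : structure L) (V : Type)
    (e : V -> M) (f : V -> N) : Prop :=
  forall phi : formula L V, sat phi e <-> sat phi f.

Definition elementary_embedding (L : language) (M N : structure L)
    (iota : M -> N) : Prop :=
  same_type (fun a : M => a) iota.

Definition automorphism (L : language) (N : structure L) (s : N -> N) : Prop :=
  [/\ bijective s,
      forall (f : fsymb L) xs, s (finterp xs) = finterp (s \o xs :> ('I_(farity f) -> N))
    & forall (r : rsymb L) xs,
        rinterp xs <-> rinterp (s \o xs :> ('I_(rarity r) -> N))].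

Definition automorphism_over (L : language) (N : structure L) (P : Type)
    (c : P -> N) (s : N -> N) : Prop :=
  automorphism s /\ forall p, s (c p) = c p.

Definition dcl (L : language) (M : structure L) (B : set M) (a : M) : Prop :=
  exists psi : formula L (unit + B),
    forall x : M, sat psi (join (fun=> x) (@set_val M B)) <-> x = a.

Definition type_definable (L : language) (N : structure L) (P : Type)
    (c : P -> N) (V : finType) (X : set (V -> N)) : Prop :=
  exists p : set (formula L (V + P)),
    X = [set x | forall phi, p phi -> sat phi (join x c)].

Definition invariant (L : language) (N : structure L) (P : Type)
    (c : P -> N) (V : finType) (X : set (V -> N)) : Prop :=
  forall s, automorphism_over c s -> forall x, X x -> X (s \o x).

(* A cardinal is represented by a type of that cardinality. *)
Definition small (kappa : Type) (T : Type) (X : set T) : Prop :=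
  (X #<= [set: kappa]) && ~~ ([set: kappa] #<= X).

Definition saturated (kappa : Type) (L : language) (N : structure L) : Prop :=
  forall C : set N, small kappa C ->
  forall (V : finType) (p : set (formula L (V + C))),
    (forall q : set (formula L (V + C)), finite_set q -> q `<=` p ->
       exists x : V -> N, forall phi, q phi -> sat phi (join x (@set_val N C))) ->
    exists x : V -> N, forall phi, p phi -> sat phi (join x (@set_val N C)).

Definition strongly_homogeneous (kappa : Type) (L : language)
    (N : structure L) : Prop :=
  forall C : set N, small kappa C ->
  forall f : C -> N, same_type (@set_val N C) f ->
    exists s : N -> N, automorphism s /\ forall c : C, s (set_val c) = f c.

(* "Sufficiently large" is made explicit: kappa > 2^(2^|L(M)|), where |L(M)| is
   the number of formulas with parameters in M and countably many free
   variables. *)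
Definition monster (kappa : Type) (L : language) (M N : structure L)
    (iota : M -> N) : Prop :=
  [/\ small kappa [set: set (set (formula L (nat + M)))],
      elementary_embedding iota,
      saturated kappa N
    & strongly_homogeneous kappa N].

Section Groups.
Variables (T : Type) (op : T -> T -> T).

Definition is_unit (K : set T) (e : T) : Prop :=
  K e /\ forall x, K x -> op e x = x /\ op x e = x.

Definition is_group (K : set T) : Prop :=
  [/\ forall x y, K x -> K y -> K (op x y),
      forall x y z, K x -> K y -> K z -> op x (op y z) = op (op x y) z
    & exists2 e, is_unit K e &
        forall x, K x -> exists2 y, K y & op x y = e /\ op y x = e].

Definition is_abelian_group (K : set T) : Prop :=
  is_group K /\ forall x y, K x -> K y -> op x y = op y x.

Definition subgroup (K H : set T) : Prop := H `<=` K /\ is_group H.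

Definition cosets (K H : set T) : set (set T) :=
  [set [set op x y | y in H] | x in K].

Definition normal_subgroup (K H : set T) : Prop :=
  subgroup K H /\
  forall x, K x -> [set op x y | y in H] = [set op y x | y in H].

Definition setop (C D : set T) : set T := [set op x y | x in C & y in D].

(* For normal subgroups N1 of H1 and N2 of H2, the quotient H1 / N1 is
   [cosets H1 N1] with the law [setop], and likewise for H2 / N2. *)
Definition quotient_isomorphism (H1 N1 H2 N2 : set T)
    (phi : set T -> set T) : Prop :=
  set_bij (cosets H1 N1) (cosets H2 N2) phi /\
  forall C D, cosets H1 N1 C -> cosets H1 N1 D ->
    phi (setop C D) = setop (phi C) (phi D).

Definition quotient_abelian (H N : set T) : Prop :=
  forall C D, cosets H N C -> cosets H N D -> setop C D = setop D C.

Definition bounded_index (kappa : Type) (K H : set T) : Prop :=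
  small kappa (cosets K H).

End Groups.

Definition is_smallest (T : Type) (Q : set T -> Prop) (X : set T) : Prop :=
  Q X /\ forall Y, Q Y -> X `<=` Y.

(* H is K^00_B (below: K^000_B), where [c] enumerates B and bounded means of
   cardinality < kappa. *)
Definition is_comp00 (kappa : Type) (L : language) (N : structure L)
    (P : Type) (c : P -> N) (V : finType)
    (op : (V -> N) -> (V -> N) -> (V -> N)) (K H : set (V -> N)) : Prop :=
  is_smallest (fun H' => [/\ subgroup op K H', bounded_index op kappa K H'
                           & type_definable c H']) H.

Definition is_comp000 (kappa : Type) (L : language) (N : structure L)
    (P : Type) (c : P -> N) (V : finType)
    (op : (V -> N) -> (V -> N) -> (V -> N)) (K H : set (V -> N)) : Prop :=
  is_smallest (fun H' => [/\ subgroup op K H', bounded_index op kappa K H'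
                           & invariant c H']) H.

Definition invariant_coset_map (L : language) (N : structure L) (P : Type)
    (c : P -> N) (V : finType) (op : (V -> N) -> (V -> N) -> (V -> N))
    (K H : set (V -> N)) (phi : set (V -> N) -> set (V -> N)) : Prop :=
  forall s, automorphism_over c s -> forall C, cosets op K H C ->
    phi [set s \o x | x in C] = [set s \o x | x in phi C].

(* G and A are sets of n-tuples and m-tuples; only the restrictions of the
   operations to these sets matter. *)
Record ext_data (T : Type) (n m : nat) := ExtData {
  grp : set ('I_n -> T);
  gmul : ('I_n -> T) -> ('I_n -> T) -> ('I_n -> T);
  abg : set ('I_m -> T);
  aadd : ('I_m -> T) -> ('I_m -> T) -> ('I_m -> T);
  act : ('I_n -> T) -> ('I_m -> T) -> ('I_m -> T);
  coc : ('I_n -> T) -> ('I_n -> T) -> ('I_m -> T) }.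

Section Extension.
Variables (T : Type) (n m : nat) (D : ext_data T n m).

Definition acts_by_automorphisms : Prop :=
  [/\ forall g a, grp D g -> abg D a -> abg D (act D g a),
      forall g a b, grp D g -> abg D a -> abg D b ->
        act D g (aadd D a b) = aadd D (act D g a) (act D g b),
      forall g1 g2 a, grp D g1 -> grp D g2 -> abg D a ->
        act D (gmul D g1 g2) a = act D g1 (act D g2 a)
    & forall e a, is_unit (gmul D) (grp D) e -> abg D a -> act D e a = a].

Definition is_2cocycle : Prop :=
  [/\ forall g1 g2, grp D g1 -> grp D g2 -> abg D (coc D g1 g2),
      forall g1 g2 g3, grp D g1 -> grp D g2 -> grp D g3 ->
        aadd D (coc D g1 g2) (coc D (gmul D g1 g2) g3) =
        aadd D (coc D g1 (gmul D g2 g3)) (act D g1 (coc D g2 g3))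
    & forall e z g, is_unit (gmul D) (grp D) e -> is_unit (aadd D) (abg D) z ->
        grp D g -> coc D g e = z /\ coc D e g = z].

Definition coc_image : set ('I_m -> T) :=
  [set coc D g1 g2 | g1 in grp D & g2 in grp D].

(* The pair (a, g) is the tuple [join a g], of index type 'I_m + 'I_n. *)
Definition ext_carrier : set ('I_m + 'I_n -> T) :=
  [set join a g | a in abg D & g in grp D].

Definition ext_mul (x y : 'I_m + 'I_n -> T) : 'I_m + 'I_n -> T :=
  let a1 := x \o inl in let g1 := x \o inr in
  let a2 := y \o inl in let g2 := y \o inr in
  join (aadd D (aadd D a1 (act D g1 a2)) (coc D g1 g2)) (gmul D g1 g2).

Definition ext_abg : set ('I_m + 'I_n -> T) :=
  [set join a e | a in abg D & e in is_unit (gmul D) (grp D)].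

End Extension.

(* Formulas defining G, its product, A, its addition, the action (all without
   parameters), and the cocycle (with parameters named by P); functions are
   given by their graphs. *)
Record ext_formulas (L : language) (P : Type) (n m : nat) := ExtFormulas {
  f_grp : formula L 'I_n;
  f_gmul : formula L ('I_n + 'I_n + 'I_n);
  f_abg : formula L 'I_m;
  f_aadd : formula L ('I_m + 'I_m + 'I_m);
  f_act : formula L ('I_n + 'I_m + 'I_m);
  f_coc : formula L ('I_n + 'I_n + 'I_m + P) }.

Definition interprets (L : language) (N : structure L) (P : Type) (n m : nat)
    (c : P -> N) (F : ext_formulas L P n m) (D : ext_data N n m) : Prop :=
  (forall g, grp D g <-> sat (f_grp F) g) /\
  (forall a, abg D a <-> sat (f_abg F) a) /\
  (forall g1 g2, grp D g1 -> grp D g2 ->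
     forall g, gmul D g1 g2 = g <-> sat (f_gmul F) (join (join g1 g2) g)) /\
  (forall a1 a2, abg D a1 -> abg D a2 ->
     forall a, aadd D a1 a2 = a <-> sat (f_aadd F) (join (join a1 a2) a)) /\
  (forall g a, grp D g -> abg D a ->
     forall b, act D g a = b <-> sat (f_act F) (join (join g a) b)) /\
  (forall g1 g2, grp D g1 -> grp D g2 ->
     forall a, coc D g1 g2 = a <->
               sat (f_coc F) (join (join (join g1 g2) a) c)).

(* Main.v *)
Require Import Defs.
From mathcomp Require Import all_boot.
From mathcomp Require Import boolp classical_sets functions cardinality filter.
Set Implicit Arguments.
Unset Strict Implicit.
Unset Printing Implicit Defensive.
Local Open Scope classical_set_scope.
Local Open Scope card_scope.

(** Let E be the extension of the group by A, with projection pi onto G, and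
    write N00, N000 and G00, G000 for the two components of E and of G.

    The preimage of G00 under pi is type-definable over B and has bounded
    index, so it contains N00; the image of N000 under pi is B-invariant and
    has bounded index, so it contains G000.  When G000 = G00 this gives
    pi(N00) <= G00 = G000 <= pi(N000): every x in N00 is a product a k with
    k in N000 and a in N00 lying over the unit of G, that is, a in A.  Hence
    N00 = (N00 /\ A) N000, every coset of N000 in N00 meets A, and the second
    isomorphism theorem is realized by the map sending a coset C to C /\ A.
    This map is B-invariant because A is, and the quotient is abelian because
    A is ([second_isomorphism], [second_isomorphism_abelian]).

    This presupposes that N000 is normal, which is where the size of kappa
    matters ([comp000_normal]).  The core of N000, the intersection of its
    conjugates, is B-invariant, so by minimality it is enough that the core has
    bounded index.  A coset of N000 is determined by the type over M of any of
    its elements ([bounded_map_type]), so a coset x core, which is determined by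
    the permutation of cosets g N000 |-> x g N000, is determined by the set of
    the types over M of the pairs (g, x g).  So there are at most
    2^(2^|L(M)|) < kappa of them ([card_cosets_core], [type_code]).

    The statement on types is the usual one on bounded invariant equivalence
    relations, and is proved with a coheir.  Let p = tp(a / M).  By elementarity
    p is finitely satisfiable in M, so some ultrafilter on tuples of M contains
    all formulas of p; its average q is a global type invariant over M.  Take a
    set R of representatives, in p, of the classes, and d realizing q over
    M and R: d is equivalent to some r in R.  By invariance of q and
    homogeneity, every realization x of p is equivalent to every realization
    of q over B and x.  Two realizations a, b of p are thus both equivalent to
    a realization of q over B, a and b.

    The rest is bookkeeping: the parameter sets met above are small because
    kappa is infinite and a union of two small sets is small ([small_setU], by
    Zorn's lemma), and the group, action and cocycle axioms pass from M to the
    monster model because they are first order ([cocycle_transfer]). *)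

(** * Small sets *)

Lemma inj_card_le_fun T U (A : set T) (B : set U) (f : T -> U) :
  (forall x, A x -> B (f x)) -> {in A &, injective f} -> A #<= B.
Proof.
move=> AB fI; have : $|{injfun A >-> B}| by apply/injfunPex; exists f.
by case=> g; exact: inj_card_le g.
Qed.

Lemma surj_card_le_fun T U (A : set T) (B : set U) (f : U -> T) :
  A `<=` f @` B -> A #<= B.
Proof.
by move=> AB; exact: card_le_trans (subset_card_le AB) (card_image_le _ _).
Qed.

Lemma card_leT_inj T U : [set: T] #<= [set: U] ->
  exists f : T -> U, injective f.
Proof.
move=> /card_leP[g].
exists (fun x => set_val (g (SigSub (in_setT x)))) => x y /val_inj.
by move/(@inj _ _ _ g); rewrite !inE => /(_ I I)[].
Qed.

(** A maximal partial injection between X and Y is total on one side. *)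
Lemma card_le_total (X Y : Type) :
  ([set: X] #<= [set: Y]) \/ ([set: Y] #<= [set: X]).
Proof.
pose P (G : set (X * Y)) :=
  forall p q, G p -> G q -> p.1 = q.1 <-> p.2 = q.2.
have [F FP Ftot|G [PG Gmax]] := @Zorn_bigcup _ P.
  move=> p q [H FH Hp] [H' FH' H'q].
  have [HH'|H'H] := Ftot _ _ FH FH'.
    by apply: (FP _ FH') => //; exact: HH'.
  by apply: (FP _ FH) => //; exact: H'H.
have [[x xG]|allX] := pselect (exists x, forall y, ~ G (x, y)); last first.
  left; have /choice[f Gf] : forall x, exists y, G (x, y).
    by move=> x; apply: contrapT => /forallNP nG; apply: allX; exists x.
  apply: (@inj_card_le_fun _ _ _ _ f) => // x y _ _ fxy.
  exact: (PG _ _ (Gf x) (Gf y)).2.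
have [[y yG]|allY] := pselect (exists y, forall x, ~ G (x, y)); last first.
  right; have /choice[f Gf] : forall y, exists x, G (x, y).
    by move=> y; apply: contrapT => /forallNP nG; apply: allY; exists y.
  apply: (@inj_card_le_fun _ _ _ _ f) => // y z _ _ fyz.
  exact: (PG _ _ (Gf y) (Gf z)).1.
exfalso; apply: (Gmax (G `|` [set (x, y)])).
  split; first by move=> p; left.
  by move=> /(_ (x, y) (or_intror erefl)); exact: xG.
move=> [p1 p2] [q1 q2] /= [Gp|[-> ->]] [Gq|[-> ->]] //.
- exact: (PG _ _ Gp Gq).
- split=> e; [move: Gp; rewrite e => /xG|move: Gp; rewrite e => /yG] => //.
- split=> e; [move: Gq; rewrite -e => /xG|move: Gq; rewrite -e => /yG] => //.
Qed.

(** A maximal family G of injective sequences with pairwise disjoint ranges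
    leaves out only a finite part Z of Y, since otherwise a sequence of elements
    of Z could be added.  Absorbing Z in one of the sequences gives an injection
    c of Y into G times nat, and the second factor can be doubled. *)
Lemma infinite_double (Y : Type) : infinite_set [set: Y] ->
  exists h : Y * bool -> Y, injective h.
Proof.
move=> Yinf.
pose P (G : set (nat -> Y)) :=
  forall s t, G s -> G t -> forall i j, s i = t j -> s = t /\ i = j.
have [F FP Ftot|G [PG Gmax]] := @Zorn_bigcup _ P.
  move=> s t [H FH Hs] [H' FH' H't].
  have [HH'|H'H] := Ftot _ _ FH FH'.
    by apply: (FP _ FH') => //; exact: HH'.
  by apply: (FP _ FH) => //; exact: H'H.
pose Z := [set y | forall s i, G s -> s i <> y].
have Zfin : finite_set Z.
  apply: contrapT => /infiniteP/card_leP[f].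
  pose s k := set_val (f (SigSub (in_setT k))).
  have Zs k : Z (s k) by exact: set_valP.
  have sI : injective s.
    move=> i j /val_inj /(@inj _ _ _ f).
    by rewrite !inE => /(_ I I)[].
  apply: (Gmax (G `|` [set s])).
    split; first by move=> t; left.
    move=> /(_ s (or_intror erefl)) Gs; exact: (Zs 0 s 0).
  move=> t u [Gt|->] [Gu|->] i j.
  - exact: PG.
  - by move=> e; case: (Zs j t i Gt).
  - by move=> e; case: (Zs i u j Gu).
  - by move=> /sI ->.
have [s0 Gs0] : exists s0, G s0.
  apply: contrapT => /forallNP G0; apply: Yinf.
  by apply: sub_finite_set Zfin => y _ s i /G0.
have [k kI] : exists k : Y -> nat, {in Z &, injective k}.
  by apply/(@countable_injP _ Z); exact: finite_set_countable.
(* Even positions code the elements of the sequences, and the odd positions of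
   s0 code those of Z. *)
have /choice[c cP] : forall y, exists q : (nat -> Y) * nat,
    G q.1 /\ ((exists2 i, q.2 = i.*2 & q.1 i = y) \/
              [/\ Z y, q.1 = s0 & q.2 = (k y).*2.+1]).
  move=> y; have [Zy|/existsNP[s /existsNP[i /not_implyP[Gs /contrapT <-]]]] :=
    pselect (Z y).
    by exists (s0, (k y).*2.+1); split=> //=; right.
  by exists (s, i.*2); split=> //; left; exists i.
have cI : injective c.
  move=> y z eyz; move: (cP y) (cP z); rewrite -eyz.
  move=> [_ [[i ei sy]|[Zy _ ey]]] [_ [[j ej sz]|[Zz _ ez]]].
  - by rewrite -sy -sz; congr (_ _); apply: double_inj; rewrite -ei.
  - by move: ez; rewrite ei => /(congr1 odd) /=; rewrite !odd_double.
  - by move: ej; rewrite ey => /(congr1 odd) /=; rewrite !odd_double.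
  - by apply: kI; rewrite ?inE //; move: ez; rewrite ey => -[] /double_inj.
exists (fun p : Y * bool => (c p.1).1 ((c p.1).2.*2 + p.2)) => -[y b] [z b'] /=.
move=> /(PG _ _ (cP y).1 (cP z).1)[e1 e2].
have eb : b = b' by move/(congr1 odd): e2; rewrite !oddD !odd_double /= !oddb.
move: e2; rewrite eb => /addIn/double_inj e2.
congr pair => //; apply: cI.
by rewrite (surjective_pairing (c y)) e1 e2 -surjective_pairing.
Qed.

Lemma card_le_setU T U (X Y : set T) (Z : set U) :
  infinite_set Z -> X #<= Z -> Y #<= Z -> (X `|` Y) #<= Z.
Proof.
move=> Zinf.
rewrite -(card_le_eql (card_setT X)) -(card_le_eqr (card_setT Z)).
move=> /card_leT_inj[f fI].
rewrite -(card_le_eql (card_setT Y)) -(card_le_eqr (card_setT Z)).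
move=> /card_leT_inj[g gI].
have [|h hI] := @infinite_double Z.
  move=> Zfin; apply: Zinf; apply: card_le_finite Zfin.
  by rewrite (card_le_eqr (card_setT Z)).
rewrite -(card_le_eqr (card_setT Z)).
apply: (@card_le_trans _ (X + Y)%type _ setT).
  apply: (@surj_card_le_fun _ _ _ _ (join (@set_val T X) (@set_val T Y))).
  move=> x [Xx|Yx]; first by exists (inl (SigSub (mem_set Xx))).
  by exists (inr (SigSub (mem_set Yx))).
apply: (@inj_card_le_fun _ _ _ _
  (fun s => match s with inl x => h (f x, true)
                       | inr y => h (g y, false) end)) => //.
by move=> [x|y] [x'|y'] _ _ /hI [] => [/fI|//|//|/gI] ->.
Qed.

Lemma card_le_small (kappa T U : Type) (X : set T) (Y : set U) :
  X #<= Y -> small kappa Y -> small kappa X.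
Proof.
move=> XY /andP[Yk kY]; apply/andP; split; first exact: card_le_trans Yk.
by apply: contraNN kY => /card_le_trans; apply.
Qed.

Lemma finite_small (kappa T : Type) (X : set T) :
  infinite_set [set: kappa] -> finite_set X -> small kappa X.
Proof.
move=> kinf Xfin; apply/andP; split.
  apply: (card_le_trans (finite_set_countable Xfin)).
  by apply/infiniteP.
by apply/negP => /card_le_finite/(_ Xfin).
Qed.

(** By comparability one may assume X #<= Y; then doubling Y applies when Y is
    infinite. *)
Lemma small_setU (kappa T : Type) (X Y : set T) :
  infinite_set [set: kappa] ->
  small kappa X -> small kappa Y -> small kappa (X `|` Y).
Proof.
move=> kinf; wlog XY : X Y / X #<= Y => [th|] sX sY.
  have [] := card_le_total X Y;
    rewrite (card_le_eql (card_setT _)) (card_le_eqr (card_setT _)) => XY.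
    exact: th.
  by rewrite setUC; exact: th.
have [Yfin|Yinf] := pselect (finite_set Y).
  apply: finite_small => //; rewrite finite_setU; split => //.
  exact: card_le_finite Yfin.
by apply: card_le_small sY; exact: card_le_setU.
Qed.

(** * Renaming, quantification over tuples, automorphisms *)

Section Formulas.
Variable L : language.

Fixpoint trename (V W : Type) (r : V -> W) (t : term L V) : term L W :=
  match t with
  | Var v => Var _ (r v)
  | App f ts => App (fun i => trename r (ts i))
  end.

(** Renaming is the only substitution needed: parameters are variables too, so
    restricting, extending and permuting parameter sets are all renamings. *)
Fixpoint frename (V W : Type) (r : V -> W) (phi : formula L V) :
    formula L W :=
  match phi with
  | Fbot => Fbot _ _
  | Feq s t => Feq (trename r s) (trename r t)
  | Frel R ts => Frel (fun i => trename r (ts i))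
  | Fimp p q => Fimp (frename r p) (frename r q)
  | Fall p => Fall (frename (omap r) p)
  end.

Definition Fnot V (p : formula L V) := Fimp p (Fbot _ _).
Definition Fand V (p q : formula L V) := Fnot (Fimp p (Fnot q)).

Lemma teval_rename (N : structure L) V W (r : V -> W) (t : term L V)
    (e : W -> N) : teval e (trename r t) = teval (e \o r) t.
Proof. by elim: t => //= f ts IH; congr finterp; apply/funext => i. Qed.

Lemma sat_rename (N : structure L) V W (r : V -> W) (phi : formula L V)
    (e : W -> N) : sat (frename r phi) e <-> sat phi (e \o r).
Proof.
elim: phi W r e => {V} [V|V s t|V R ts|V p IHp q IHq|V p IHp] W r e //=.
- by rewrite !teval_rename.
- suff -> : (fun i => teval e (trename r (ts i))) =
            (fun i => teval (e \o r) (ts i)) by [].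
  by apply/funext => i; rewrite teval_rename.
- by rewrite IHp IHq.
- split=> H a; move/(_ a): H; rewrite IHp.
    by congr (sat p _); apply/funext => -[].
  by congr (sat p _); apply/funext => -[].
Qed.

Lemma sat_and (N : structure L) V (p q : formula L V) (e : V -> N) :
  sat (Fand p q) e <-> sat p e /\ sat q e.
Proof.
split=> /= [H|[pe qe]]; last by move/(_ pe).
by split; apply: contrapT => n; apply: H.
Qed.

(** The formulas quantify one element at a time; the statement concerns
    quantification over tuples. *)
Lemma forall_ord_definable k W (phi : formula L ('I_k + W)) :
  exists psi : formula L W, forall (N : structure L) (e : W -> N),
    sat psi e <-> forall x : 'I_k -> N, sat phi (join x e).
Proof.
elim: k W phi => [|k IH] W phi.
  exists (frename (fun s : 'I_0 + W =>
    match s with inl i => match notF (ltn_ord i) with end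
               | inr w => w end) phi) => N e; rewrite sat_rename.
  split=> [H x|/(_ (fun i => match notF (ltn_ord i) with end))]; last first.
    by congr (sat phi _); apply/funext => -[i|//]; case: (notF (ltn_ord i)).
  move: H; congr (sat phi _).
  by apply/funext => -[i|//]; case: (notF (ltn_ord i)).
pose r (s : 'I_k.+1 + W) : option ('I_k + W) :=
  match s with inl i => omap inl (unlift ord0 i) | inr w => Some (inr w) end.
have [psi psiP] := IH _ (Fall (frename r phi)).
exists psi => N e; rewrite psiP; split=> [H x|H x a].
  have : sat (frename r phi) (scons (x ord0) (join (x \o lift ord0) e)).
    exact: (H (x \o lift ord0) (x ord0)).
  rewrite sat_rename.
  congr (sat phi _); apply/funext => -[i|//] /=.
  by case: unliftP => [j ->|->].
suff : sat (frename r phi) (scons a (join x e)) by [].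
rewrite sat_rename.
have := H (fun i => scons a x (unlift ord0 i)).
congr (sat phi _); apply/funext => -[i|//] /=.
by case: unliftP.
Qed.

Lemma forall_tuple_definable (V : finType) W (phi : formula L (V + W)) :
  exists psi : formula L W, forall (N : structure L) (e : W -> N),
    sat psi e <-> forall x : V -> N, sat phi (join x e).
Proof.
pose r (s : V + W) : 'I_#|V| + W :=
  match s with inl v => inl (enum_rank v) | inr w => inr w end.
have [psi psiP] := forall_ord_definable (frename r phi).
exists psi => N e; rewrite psiP; split=> H x.
  have := H (x \o enum_val); rewrite sat_rename; congr (sat phi _).
  by apply/funext => -[v|//] /=; rewrite enum_rankK.
by rewrite sat_rename; have := H (x \o enum_rank); congr (sat phi _);
  apply/funext => -[].
Qed.

Lemma exists_tuple_definable (V : finType) W (phi : formula L (V + W)) :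
  exists psi : formula L W, forall (N : structure L) (e : W -> N),
    sat psi e <-> exists x : V -> N, sat phi (join x e).
Proof.
have [psi psiP] := forall_tuple_definable (Fnot phi).
exists (Fnot psi) => N e /=; rewrite psiP; split.
  by move=> /existsNP[x /contrapT ?]; exists x.
by move=> [x xP] H; exact: H xP.
Qed.

End Formulas.

Section Automorphisms.
Variables (L : language) (N : structure L).

Lemma teval_automorphism (s : N -> N) V (e : V -> N) (t : term L V) :
  automorphism s -> s (teval e t) = teval (s \o e) t.
Proof.
move=> [_ sf _]; elim: t => //= f ts IH; rewrite sf; congr finterp.
by apply/funext => i /=.
Qed.

Lemma sat_automorphism (s : N -> N) V (phi : formula L V) (e : V -> N) :
  automorphism s -> sat phi e <-> sat phi (s \o e).
Proof.
move=> sA; have [[s' sK s'K] _ sr] := sA.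
elim: phi e => {V} [V|V t u|V R ts|V p IHp q IHq|V p IHp] e //=.
- rewrite -!teval_automorphism //; split=> [->//|].
  exact: can_inj sK _ _.
- rewrite sr; suff -> : s \o (fun i => teval e (ts i)) =
     (fun i => teval (s \o e) (ts i)) by [].
  by apply/funext => i /=; exact: teval_automorphism.
- by rewrite IHp IHq.
- have E a : s \o scons a e = scons (s a) (s \o e) by apply/funext => -[].
  split=> H a; first by rewrite -(s'K a) -E -IHp.
  by rewrite IHp E.
Qed.

Lemma automorphism_over_inv P (c : P -> N) (s : N -> N) :
  automorphism_over c s ->
  exists s', [/\ automorphism_over c s', cancel s s' & cancel s' s].
Proof.
move=> [[[s' sK s'K] sf sr] sc]; exists s'; split=> //.
split; last by move=> p; rewrite -[in LHS](sc p) sK.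
split; first by exists s.
- move=> f xs; apply: (can_inj sK); rewrite s'K sf; congr finterp.
  by apply/funext => i /=.
- move=> r xs; rewrite [X in _ <-> X]sr.
  by suff -> : s \o (s' \o xs) = xs by []; apply/funext => i /=.
Qed.

(** Strong homogeneity for two indexed families instead of a map defined on a
    set: equalities between members of e are part of its type, so e v |-> e' v
    is well defined. *)
Lemma homogeneous_automorphism kappa W (e e' : W -> N) :
  strongly_homogeneous kappa N -> small kappa (range e) -> same_type e e' ->
  exists s, automorphism s /\ s \o e = e'.
Proof.
move=> hom sm ee'.
have /choice[w wP] : forall c : range e, exists w, e w = set_val c.
  by move=> c; have [w _ ew] := set_valP c; exists w.
have [phi|s [sA sP]] := hom _ sm (e' \o w).
  have -> : @set_val N (range e) = e \o w by apply/funext => c /=.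
  by rewrite -sat_rename ee' sat_rename.
exists s; split=> //; apply/funext => v /=.
have ev : (range e) (e v) by exists v.
have := sP (SigSub (mem_set ev)); rewrite /= => ->.
have := wP (SigSub (mem_set ev)); rewrite /= => E.
exact: (ee' (Feq (Var _ (w (SigSub (mem_set ev)))) (Var _ v))).1.
Qed.

End Automorphisms.

(** * Transfer along an elementary embedding *)

Section Transfer.
Variables (L : language) (M N : structure L) (iota : M -> N).

(** R and R' are given by one formula with parameters in M, read in M and, along
    iota, in N.  The closure properties below show this for a first-order
    sentence written with ordinary quantifiers over tuples, without writing the
    formula. *)
Definition codefinable V (R : (V -> M) -> Prop) (R' : (V -> N) -> Prop) :=
  exists phi : formula L (V + M),
    (forall e, R e <-> sat phi (join e id)) /\
    (forall e, R' e <-> sat phi (join e iota)).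

(** The terms to which atomic formulas are applied are tuples of variables and
    of parameters. *)
Definition covariable V W (t : (V -> M) -> W -> M) (t' : (V -> N) -> W -> N) :=
  exists v : W -> V + M,
    (forall e, t e = join e id \o v) /\ (forall e, t' e = join e iota \o v).

Lemma covariable_lookup V W (v : W -> V) :
  covariable (fun e w => e (v w)) (fun e w => e (v w)).
Proof. by exists (inl \o v). Qed.

Lemma covariable_const V W (a : W -> M) :
  @covariable V W (fun=> a) (fun=> iota \o a).
Proof. by exists (inr \o a). Qed.

Lemma covariable_join V W W' t t' u u' :
  @covariable V W t t' -> @covariable V W' u u' ->
  covariable (fun e => join (t e) (u e)) (fun e => join (t' e) (u' e)).
Proof.
move=> [v [vt vt']] [w [wu wu']]; exists (join v w); split=> e; apply/funext.
  by move=> -[i|j] /=; rewrite ?vt ?wu.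
by move=> -[i|j] /=; rewrite ?vt' ?wu'.
Qed.

Lemma codefinable_sat V W t t' (phi : formula L W) :
  @covariable V W t t' ->
  codefinable (fun e => sat phi (t e)) (fun e => sat phi (t' e)).
Proof.
move=> [v [vt vt']]; exists (frename v phi); split=> e.
  by rewrite sat_rename vt.
by rewrite sat_rename vt'.
Qed.

Lemma codefinable_imp V R R' S S' :
  @codefinable V R R' -> @codefinable V S S' ->
  codefinable (fun e => R e -> S e) (fun e => R' e -> S' e).
Proof.
move=> [p [pM pN]] [q [qM qN]]; exists (Fimp p q).
by split=> e /=; rewrite ?pM ?qM ?pN ?qN.
Qed.

Lemma codefinable_and V R R' S S' :
  @codefinable V R R' -> @codefinable V S S' ->
  codefinable (fun e => R e /\ S e) (fun e => R' e /\ S' e).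
Proof.
move=> [p [pM pN]] [q [qM qN]]; exists (Fand p q).
by split=> e; rewrite sat_and ?pM ?qM ?pN ?qN.
Qed.

Let swap_binder (V : Type) (K : Type) (s : (K + V) + M) : K + (V + M) :=
  match s with inl (inl k) => inl k | inl (inr v) => inr (inl v)
             | inr m => inr (inr m) end.

Let swap_binderE (X : structure L) V K (x : K -> X) (e : V -> X) (i : M -> X) :
  join x (join e i) \o @swap_binder V K = join (join x e) i.
Proof. by apply/funext => -[[]|]. Qed.

Lemma codefinable_all V (K : finType) (R : (K -> M) -> (V -> M) -> Prop)
    (R' : (K -> N) -> (V -> N) -> Prop) :
  codefinable (fun e : K + V -> M => R (e \o inl) (e \o inr))
              (fun e => R' (e \o inl) (e \o inr)) ->
  codefinable (fun e => forall x, R x e) (fun e => forall x, R' x e).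
Proof.
move=> [p [pM pN]].
have [q qP] := forall_tuple_definable (frename (@swap_binder V K) p).
exists q; split=> e; rewrite qP; split=> H x.
- by rewrite sat_rename swap_binderE -pM; exact: H.
- by have := H x; rewrite sat_rename swap_binderE -pM.
- by rewrite sat_rename swap_binderE -pN; exact: H.
- by have := H x; rewrite sat_rename swap_binderE -pN.
Qed.

Lemma codefinable_ex V (K : finType) (R : (K -> M) -> (V -> M) -> Prop)
    (R' : (K -> N) -> (V -> N) -> Prop) :
  codefinable (fun e : K + V -> M => R (e \o inl) (e \o inr))
              (fun e => R' (e \o inl) (e \o inr)) ->
  codefinable (fun e => exists x, R x e) (fun e => exists x, R' x e).
Proof.
move=> [p [pM pN]].
have [q qP] := exists_tuple_definable (frename (@swap_binder V K) p).
exists q; split=> e; rewrite qP; split=> -[x H]; exists x.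
- by rewrite sat_rename swap_binderE -pM.
- by move: H; rewrite sat_rename swap_binderE -pM.
- by rewrite sat_rename swap_binderE -pN.
- by move: H; rewrite sat_rename swap_binderE -pN.
Qed.

Lemma codefinable_transfer (R R' : Prop) :
  elementary_embedding iota ->
  @codefinable void (fun=> R) (fun=> R') -> R -> R'.
Proof.
move=> el [p [pM pN]] H.
have := el (frename (join (fun v : void => match v with end) id) p).
rewrite !sat_rename.
have -> : id \o join (fun v : void => match v with end) id =
  join (fun v : void => match v with end) id :> (void + M -> M).
  by apply/funext => -[].
have -> : iota \o join (fun v : void => match v with end) id =
  join (fun v : void => match v with end) iota.
  by apply/funext => -[].
by rewrite -pM -pN => -[+ _]; apply.
Qed.

End Transfer.

(** The tuple quantified k steps ago is found in the current valuation through
    the composite inr \o ... \o inr \o inl with k occurrences of inr. *)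
Ltac lookup v :=
  first [ refine (covariable_lookup _ v)
        | let w := uconstr:(inr \o v) in lookup w ].

Ltac codefinability :=
  repeat first
  [ apply: codefinable_all | apply: codefinable_ex | apply: codefinable_imp
  | apply: codefinable_and | apply: codefinable_sat | apply: covariable_join
  | exact: covariable_const
  | lookup uconstr:(inl) ].

(** * First-order axioms for a group extension by a cocycle *)

Section FirstOrderGroups.
Variables (L : language) (k : nat).
Variables (G : formula L 'I_k) (Mul : formula L ('I_k + 'I_k + 'I_k)).

(** Multiplication is replaced by its graph and a unit is named, which makes the
    axioms first order. *)
Definition group_axioms (N : structure L) (e : 'I_k -> N) : Prop :=
  (forall x y z : 'I_k -> N, sat G x -> sat G y ->
     sat Mul (join (join x y) z) -> sat G z) /\
  (forall x y z u v w : 'I_k -> N, sat G x -> sat G y -> sat G z ->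
     sat Mul (join (join y z) u) -> sat Mul (join (join x y) v) ->
     sat Mul (join (join x u) w) -> sat Mul (join (join v z) w)) /\
  sat G e /\
  (forall x : 'I_k -> N, sat G x ->
     sat Mul (join (join e x) x) /\ sat Mul (join (join x e) x)) /\
  (forall x : 'I_k -> N, sat G x -> exists y : 'I_k -> N, sat G y /\
     (sat Mul (join (join x y) e) /\ sat Mul (join (join y x) e))).

Section Interpretation.
Variables (N : structure L) (K : set ('I_k -> N)).
Variable op : ('I_k -> N) -> ('I_k -> N) -> ('I_k -> N).
Hypothesis KP : forall g, K g <-> sat G g.
Hypothesis opP : forall g1 g2, K g1 -> K g2 ->
  forall g, op g1 g2 = g <-> sat Mul (join (join g1 g2) g).

Lemma group_axioms_of_group e :
  is_group op K -> is_unit op K e -> group_axioms e.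
Proof.
move=> [cl as_ [e' [Ke' ue'] inv]] [Ke ue].
have <- : e' = e by rewrite -(ue' _ Ke).1 (ue _ Ke').2.
split; [|split; [|split; [|split]]].
- by move=> x y z; rewrite -!KP => Kx Ky; rewrite -opP // => <-; exact: cl.
- move=> x y z u v w; rewrite -!KP => Kx Ky Kz.
  rewrite -(opP Ky Kz) -(opP Kx Ky) => <- <-.
  rewrite -(opP Kx (cl _ _ Ky Kz)) -(opP (cl _ _ Kx Ky) Kz).
  by rewrite as_.
- by rewrite -KP.
- by move=> x; rewrite -!KP => Kx; rewrite -!opP //; exact: ue'.
- move=> x; rewrite -KP => /[dup] Kx /inv[y Ky yP]; exists y.
  by rewrite -!opP // -KP.
Qed.

Lemma group_of_group_axioms e :
  group_axioms e -> is_group op K /\ is_unit op K e.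
Proof.
move=> [cl [as_ [Ge [ue inv]]]].
have Kcl x y : K x -> K y -> K (op x y).
  move=> Kx Ky; apply/KP; apply: (cl x y).
  - exact/KP.
  - exact/KP.
  - exact/opP.
have Ke : K e by exact/KP.
have uP : is_unit op K e.
  by split=> // x /[dup] Kx /KP/ue; rewrite -!opP.
split=> //; split=> //; last first.
  exists e => // x /[dup] Kx /KP/inv[y [/KP Ky]]; rewrite -!opP // => ?.
  by exists y.
move=> x y z Kx Ky Kz; apply/esym/opP => //; first exact: Kcl.
apply: (as_ x y z (op y z)); try exact/KP; apply/opP => //.
exact: Kcl.
Qed.

End Interpretation.

End FirstOrderGroups.

Section FirstOrderExtensions.
Variables (L : language) (P : Type) (n m : nat) (F : ext_formulas L P n m).

Definition ext_axioms (N : structure L) (c : P -> N)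
    (e : 'I_n -> N) (z : 'I_m -> N) : Prop :=
  (group_axioms (f_grp F) (f_gmul F) e /\ group_axioms (f_abg F) (f_aadd F) z /\
  (forall (x y w : 'I_m -> N), sat (f_abg F) x -> sat (f_abg F) y ->
     sat (f_aadd F) (join (join x y) w) -> sat (f_aadd F) (join (join y x) w)))
  /\
  ((forall (g : 'I_n -> N) (a b : 'I_m -> N),
     sat (f_grp F) g -> sat (f_abg F) a ->
     sat (f_act F) (join (join g a) b) -> sat (f_abg F) b) /\
  (forall (g : 'I_n -> N) (a b s a' b' s' : 'I_m -> N),
     sat (f_grp F) g -> sat (f_abg F) a -> sat (f_abg F) b ->
     sat (f_aadd F) (join (join a b) s) ->
     sat (f_act F) (join (join g a) a') -> sat (f_act F) (join (join g b) b') ->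
     sat (f_act F) (join (join g s) s') ->
     sat (f_aadd F) (join (join a' b') s')) /\
  (forall (g1 g2 g : 'I_n -> N) (a b s : 'I_m -> N),
     sat (f_grp F) g1 -> sat (f_grp F) g2 ->
     sat (f_abg F) a -> sat (f_gmul F) (join (join g1 g2) g) ->
     sat (f_act F) (join (join g2 a) b) -> sat (f_act F) (join (join g1 b) s) ->
     sat (f_act F) (join (join g a) s)) /\
  (forall a : 'I_m -> N,
     sat (f_abg F) a -> sat (f_act F) (join (join e a) a)))
  /\
  ((forall (g1 g2 : 'I_n -> N) (a : 'I_m -> N),
     sat (f_grp F) g1 -> sat (f_grp F) g2 ->
     sat (f_coc F) (join (join (join g1 g2) a) c) -> sat (f_abg F) a) /\
  (forall (g1 g2 g3 g12 g23 : 'I_n -> N) (h1 h2 h3 h4 h5 s : 'I_m -> N),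
     sat (f_grp F) g1 -> sat (f_grp F) g2 -> sat (f_grp F) g3 ->
     sat (f_gmul F) (join (join g1 g2) g12) ->
     sat (f_gmul F) (join (join g2 g3) g23) ->
     sat (f_coc F) (join (join (join g1 g2) h1) c) ->
     sat (f_coc F) (join (join (join g12 g3) h2) c) ->
     sat (f_coc F) (join (join (join g1 g23) h3) c) ->
     sat (f_coc F) (join (join (join g2 g3) h4) c) ->
     sat (f_act F) (join (join g1 h4) h5) ->
     sat (f_aadd F) (join (join h1 h2) s) ->
     sat (f_aadd F) (join (join h3 h5) s)) /\
  (forall (g : 'I_n -> N), sat (f_grp F) g ->
     sat (f_coc F) (join (join (join g e) z) c) /\
     sat (f_coc F) (join (join (join e g) z) c))).

Lemma ext_axioms_transfer (M N : structure L) (iota : M -> N)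
    (c : P -> M) (e : 'I_n -> M) (z : 'I_m -> M) :
  elementary_embedding iota -> ext_axioms c e z ->
  ext_axioms (iota \o c) (iota \o e) (iota \o z).
Proof.
move=> el; apply: (codefinable_transfer el).
by rewrite /ext_axioms /group_axioms; codefinability.
Qed.

Section Interpretation.
Variables (N : structure L) (c : P -> N) (D : ext_data N n m).
Hypothesis FD : interprets c F D.

Let GP : forall g, grp D g <-> sat (f_grp F) g. Proof. exact: FD.1. Qed.
Let AP : forall g, abg D g <-> sat (f_abg F) g. Proof. exact: FD.2.1. Qed.
Let mulP : forall g1 g2, grp D g1 -> grp D g2 ->
  forall g, gmul D g1 g2 = g <-> sat (f_gmul F) (join (join g1 g2) g).
Proof. exact: FD.2.2.1. Qed.
Let addP : forall g1 g2, abg D g1 -> abg D g2 ->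
  forall g, aadd D g1 g2 = g <-> sat (f_aadd F) (join (join g1 g2) g).
Proof. exact: FD.2.2.2.1. Qed.
Let actP : forall g1 g2, grp D g1 -> abg D g2 ->
  forall g, act D g1 g2 = g <-> sat (f_act F) (join (join g1 g2) g).
Proof. exact: FD.2.2.2.2.1. Qed.
Let cocP : forall g1 g2, grp D g1 -> grp D g2 ->
  forall g, coc D g1 g2 = g <-> sat (f_coc F) (join (join (join g1 g2) g) c).
Proof. exact: FD.2.2.2.2.2. Qed.

Lemma ext_axioms_of_cocycle e z :
  is_group (gmul D) (grp D) -> is_abelian_group (aadd D) (abg D) ->
  acts_by_automorphisms D -> is_2cocycle D ->
  is_unit (gmul D) (grp D) e -> is_unit (aadd D) (abg D) z ->
  ext_axioms c e z.
Proof.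
move=> gG [gA comm] [acl aadd_ amul aone] [ccl ceq cone] ue uz.
have [Gcl _ _] := gG; have [Acl _ _] := gA.
split; [split; [|split]|split; [split; [|split; [|split]]|split; [|split]]].
- exact: group_axioms_of_group gG ue.
- exact: group_axioms_of_group gA uz.
- move=> x y w; rewrite -!AP => Kx Ky; rewrite -!addP // => <-.
  exact: comm.
- move=> g a b; rewrite -GP -!AP => Gg Aa.
  by rewrite -actP // => <-; exact: acl.
- move=> g a b s a' b' s'; rewrite -GP -!AP => Gg Aa Ab.
  rewrite -(addP Aa Ab) -(actP Gg Aa) -(actP Gg Ab) => <- <- <-.
  rewrite -(actP Gg (Acl _ _ Aa Ab)) => <-.
  by rewrite -(addP (acl _ _ Gg Aa) (acl _ _ Gg Ab)) aadd_.
- move=> g1 g2 g a b s; rewrite -!GP -!AP => Gg1 Gg2 Aa.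
  rewrite -(mulP Gg1 Gg2) -(actP Gg2 Aa) => <- <-.
  rewrite -(actP Gg1 (acl _ _ Gg2 Aa)) -(actP (Gcl _ _ Gg1 Gg2) Aa).
  by rewrite amul.
- move=> a; rewrite -AP => Aa; rewrite -actP //; last exact: ue.1.
  exact: aone.
- move=> g1 g2 a; rewrite -!GP -!AP => G1 G2.
  by rewrite -cocP // => <-; exact: ccl.
- move=> g1 g2 g3 g12 g23 h1 h2 h3 h4 h5 s; rewrite -!GP => G1 G2 G3.
  rewrite -(mulP G1 G2) -(mulP G2 G3) => <- <-.
  have G12 := Gcl _ _ G1 G2; have G23 := Gcl _ _ G2 G3.
  rewrite -(cocP G1 G2) -(cocP G12 G3) -(cocP G1 G23) -(cocP G2 G3).
  move=> <- <- <- <-; rewrite -(actP G1 (ccl _ _ G2 G3)) => <-.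
  rewrite -(addP (ccl _ _ G1 G2) (ccl _ _ G12 G3)) => <-.
  rewrite -(addP (ccl _ _ G1 G23) (acl _ _ G1 (ccl _ _ G2 G3))).
  by rewrite ceq.
- move=> g; rewrite -GP => Gg; rewrite -(cocP Gg ue.1) -(cocP ue.1 Gg).
  exact: cone.
Qed.

Lemma cocycle_of_ext_axioms e z : ext_axioms c e z ->
  [/\ is_group (gmul D) (grp D), is_abelian_group (aadd D) (abg D),
      acts_by_automorphisms D, is_2cocycle D &
      is_unit (gmul D) (grp D) e /\ is_unit (aadd D) (abg D) z].
Proof.
move=> [[gG [gA comm]] [[acl [aadd_ [amul aone]]] [ccl [ceq cone]]]].
have [{}gG ue] := group_of_group_axioms GP mulP gG.
have [{}gA uz] := group_of_group_axioms AP addP gA.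
have [Gcl _ _] := gG; have [Acl _ _] := gA.
have unitE T (op : T -> T -> T) K (x y : T) :
    is_unit op K x -> is_unit op K y -> x = y.
  by move=> [Kx xu] [Ky yu]; rewrite -(yu _ Kx).1 (xu _ Ky).2.
have Gact g a : grp D g -> abg D a -> abg D (act D g a).
  move=> Gg Aa; apply/AP; apply: (acl g a); [exact/GP|exact/AP|exact/actP].
have Gcoc g h : grp D g -> grp D h -> abg D (coc D g h).
  move=> Gg Gh; apply/AP; apply: (ccl g h); [exact/GP|exact/GP|exact/cocP].
split=> //.
- split=> // x y Kx Ky; apply/esym/addP => //; apply: comm.
  + exact/AP.
  + exact/AP.
  + exact/addP.
- split=> //.
  + move=> g a b Gg Aa Ab; apply/esym/addP; try exact: Gact.
    apply: (aadd_ g a b (aadd D a b));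
      try by [exact/GP|exact/AP|exact/actP|exact/addP].
    by apply/actP => //; exact: Acl.
  + move=> g1 g2 a G1 G2 Aa; apply/actP => //; first exact: Gcl.
    apply: (amul g1 g2 _ _ (act D g2 a));
      try by [exact/GP|exact/AP|exact/actP|exact/mulP].
    by apply/actP => //; exact: Gact.
  + move=> e' a ue' Aa; rewrite (unitE _ _ _ _ _ ue' ue).
    apply/actP => //; first exact: ue.1.
    by apply: aone; exact/AP.
- split=> //.
  + move=> g1 g2 g3 G1 G2 G3.
    have G12 := Gcl _ _ G1 G2; have G23 := Gcl _ _ G2 G3.
    apply/esym/addP; [exact: Gcoc|exact: Gact (Gcoc _ _ _ _)|].
    apply: (ceq g1 g2 g3 (gmul D g1 g2) (gmul D g2 g3)
      (coc D g1 g2) (coc D (gmul D g1 g2) g3) _ (coc D g2 g3));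
      try by [exact/GP|exact/mulP|exact/cocP].
      by apply/actP => //; exact: Gcoc.
    by apply/addP => //; exact: Gcoc.
  + move=> e' z' g ue' uz' Gg; rewrite (unitE _ _ _ _ _ ue' ue).
    rewrite (unitE _ _ _ _ _ uz' uz).
    by have := cone g ((GP g).1 Gg); rewrite -(cocP Gg ue.1) -(cocP ue.1 Gg).
Qed.

End Interpretation.

(** The units of G and A over M serve as parameters, so that the axioms on units
    also transfer. *)
Lemma cocycle_transfer (M N : structure L) (iota : M -> N) (c : P -> M)
    (D : ext_data M n m) (D' : ext_data N n m) :
  elementary_embedding iota ->
  interprets c F D -> interprets (iota \o c) F D' ->
  is_group (gmul D) (grp D) -> is_abelian_group (aadd D) (abg D) ->
  acts_by_automorphisms D -> is_2cocycle D ->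
  [/\ is_group (gmul D') (grp D'), is_abelian_group (aadd D') (abg D'),
      acts_by_automorphisms D' & is_2cocycle D'].
Proof.
move=> el FD FD' gG gA ac co.
have [_ _ [e ue _]] := gG; have [[_ _ [z uz _]] _] := gA.
have ax := ext_axioms_of_cocycle FD gG gA ac co ue uz.
by have [] := cocycle_of_ext_axioms FD' (ext_axioms_transfer el ax).
Qed.

End FirstOrderExtensions.

(** * Groups carried by sets, cosets and cores *)

(** [is_group] with a chosen unit and inverse; all groups below are of this form
    and a subgroup shares the unit and inverse of the ambient group. *)
Record group_laws (T : Type) (op : T -> T -> T) (K : set T) (e : T)
    (inv : T -> T) : Prop := GroupLaws {
  gl_mul : forall x y, K x -> K y -> K (op x y);
  gl_mulA : forall x y z, K x -> K y -> K z ->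
    op x (op y z) = op (op x y) z;
  gl_one : K e;
  gl_1mul : forall x, K x -> op e x = x;
  gl_mul1 : forall x, K x -> op x e = x;
  gl_inv : forall x, K x -> K (inv x);
  gl_mulV : forall x, K x -> op x (inv x) = e;
  gl_Vmul : forall x, K x -> op (inv x) x = e }.

Lemma group_laws_exist (T : Type) (op : T -> T -> T) (K : set T) :
  is_group op K -> exists e inv, group_laws op K e inv.
Proof.
move=> [cl as_ [e [Ke ue] inv]].
have /choice[i iP] : forall x, exists y,
    K x -> [/\ K y, op x y = e & op y x = e].
  move=> x; have [/inv[y Ky [xy yx]]|nKx] := pselect (K x); first by exists y.
  by exists x.
exists e, i; split=> // x Kx.
- by have [] := ue _ Kx.
- by have [] := ue _ Kx.
- by have [] := iP _ Kx.
- by have [] := iP _ Kx.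
- by have [] := iP _ Kx.
Qed.

Lemma group_laws_group (T : Type) (op : T -> T -> T) (K : set T) e inv :
  group_laws op K e inv -> is_group op K.
Proof.
move=> gl; split; [exact: gl_mul gl|exact: gl_mulA gl|].
exists e.
  by split=> [|x Kx]; [exact: gl_one gl|rewrite (gl_1mul gl) ?(gl_mul1 gl)].
move=> x Kx; exists (inv x); first exact: gl_inv gl _ _.
by rewrite (gl_mulV gl) ?(gl_Vmul gl).
Qed.

(** If y x = e and w y = e, then x y = (w y) (x y) = w (y x) y = w y = e. *)
Lemma left_group_is_group (T : Type) (op : T -> T -> T) (K : set T) e :
  (forall x y, K x -> K y -> K (op x y)) ->
  (forall x y z, K x -> K y -> K z -> op x (op y z) = op (op x y) z) ->
  K e -> (forall x, K x -> op e x = x) ->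
  (forall x, K x -> exists2 y, K y & op y x = e) -> is_group op K.
Proof.
move=> cl as_ Ke e1 invl.
have right x y : K x -> K y -> op y x = e -> op x y = e.
  move=> Kx Ky yx; have [w Kw wy] := invl _ Ky.
  have Kxy := cl _ _ Kx Ky.
  by rewrite -(e1 _ Kxy) -{1}wy -as_ // (as_ y x y) // yx e1.
split=> //; exists e.
  split=> // x Kx; split; first exact: e1.
  have [y Ky yx] := invl _ Kx.
  by rewrite -yx as_ // (right x y) // e1.
move=> x Kx; have [y Ky yx] := invl _ Kx.
by exists y => //; split=> //; exact: right.
Qed.

Section SetGroups.
Variables (T : Type) (op : T -> T -> T) (K : set T) (e : T) (inv : T -> T).
Hypothesis gl : group_laws op K e inv.

Definition lcoset (x : T) (H : set T) : set T := [set op x h | h in H].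

Let KM := gl_mul gl.
Let KA := gl_mulA gl.
Let K1 := gl_one gl.
Let K1x := gl_1mul gl.
Let Kx1 := gl_mul1 gl.
Let KV := gl_inv gl.
Let KxV := gl_mulV gl.
Let KVx := gl_Vmul gl.

Lemma gl_mulKV x y : K x -> K y -> op x (op (inv x) y) = y.
Proof. by move=> Kx Ky; rewrite KA ?KxV ?K1x //; exact: KV. Qed.

Lemma gl_mulK x y : K x -> K y -> op (inv x) (op x y) = y.
Proof. by move=> Kx Ky; rewrite KA ?KVx ?K1x //; exact: KV. Qed.

Lemma gl_mulI x y z : K x -> K y -> K z -> op x y = op x z -> y = z.
Proof. by move=> Kx Ky Kz E; rewrite -(gl_mulK Kx Ky) E gl_mulK. Qed.

Lemma gl_invK x : K x -> inv (inv x) = x.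
Proof.
move=> Kx; have Vx := KV Kx.
by apply: (gl_mulI Vx (KV Vx) Kx); rewrite KxV // KVx.
Qed.

Lemma subgroup_laws H : subgroup op K H -> group_laws op H e inv.
Proof.
move=> [HK [cl as_ [e' [He' ue'] invH]]].
have ee' : e' = e.
  apply: (gl_mulI (HK _ He') (HK _ He') K1).
  by rewrite (ue' _ He').1 Kx1 //; exact: HK.
subst e'; split=> // x Hx.
- by have [] := ue' _ Hx.
- by have [] := ue' _ Hx.
- have [y Hy [xy _]] := invH _ Hx; suff -> : inv x = y by [].
  apply: (gl_mulI (HK _ Hx) (KV (HK _ Hx)) (HK _ Hy)).
  by rewrite xy KxV //; exact: HK.
- by rewrite KxV //; exact: HK.
- by rewrite KVx //; exact: HK.
Qed.

Lemma subgroup_of_closed H : H `<=` K -> H e ->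
  (forall x y, H x -> H y -> H (op x y)) -> (forall x, H x -> H (inv x)) ->
  subgroup op K H.
Proof.
move=> HK He HM HV; split=> //.
by apply: (@group_laws_group _ _ _ e inv); split=> // *;
  [exact: KA (HK _ _) (HK _ _) (HK _ _)|exact: K1x (HK _ _)
  |exact: Kx1 (HK _ _)|exact: KxV (HK _ _)|exact: KVx (HK _ _)].
Qed.

Section Cosets.
Variable H : set T.
Hypothesis sH : subgroup op K H.
Let HK : H `<=` K := sH.1.
Let gH := subgroup_laws sH.

Lemma lcoset_mem x : K x -> lcoset x H x.
Proof. by move=> Kx; exists e; [exact: gl_one gH|exact: Kx1]. Qed.

Lemma lcosetP x y : K x -> K y -> lcoset x H y <-> H (op (inv x) y).
Proof.
move=> Kx Ky; split=> [[h Hh <-]|Hxy]; first by rewrite gl_mulK //; exact: HK.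
by exists (op (inv x) y); rewrite ?gl_mulKV.
Qed.

Lemma lcoset_eqP x y : K x -> K y -> lcoset x H = lcoset y H <-> lcoset x H y.
Proof.
move=> Kx Ky; split=> [->|[h Hh <-]]; first exact: lcoset_mem.
have Kh := HK Hh; apply/seteqP; split=> _ [k Hk <-].
  exists (op (inv h) k).
    by apply: gl_mul gH _ _ _ _ => //; exact: gl_inv gH _ _.
  by rewrite -KA ?gl_mulKV //; [exact: HK|exact: KM (KV Kh) (HK _)].
exists (op h k); first exact: gl_mul gH _ _ _ _.
by rewrite KA //; exact: HK.
Qed.

Lemma lcoset_mul g x y : K g -> K x -> K y ->
  lcoset x H = lcoset y H -> lcoset (op g x) H = lcoset (op g y) H.
Proof.
move=> Kg Kx Ky /lcoset_eqP -/(_ Kx Ky) [h Hh <-].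
apply/lcoset_eqP; [exact: KM|exact: KM Kg (KM Kx (HK _))|].
by exists h => //; rewrite KA //; exact: HK.
Qed.

End Cosets.

Section Core.
Variable H : set T.
Hypothesis sH : subgroup op K H.
Let HK : H `<=` K := sH.1.

(** The intersection of the conjugates of H, as the kernel of the action of K on
    the left cosets of H. *)
Definition core : set T :=
  [set x | K x /\ forall g, K g -> lcoset (op x g) H = lcoset g H].

Lemma core_sub : core `<=` H.
Proof.
move=> x [Kx /(_ e K1)]; rewrite Kx1 // => E.
have : lcoset e H x by rewrite -E; exact: lcoset_mem.
by move=> [h Hh <-]; rewrite K1x //; exact: HK.
Qed.

Lemma subgroup_core : subgroup op K core.
Proof.
apply: subgroup_of_closed.
- by move=> x [].
- by split=> // g Kg; rewrite K1x.
- move=> x y [Kx xP] [Ky yP]; split; first exact: KM.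
  by move=> g Kg; rewrite -KA // xP ?yP //; exact: KM.
- move=> x [Kx xP]; have Vx := KV Kx; split=> // g Kg.
  by have := xP _ (KM Vx Kg); rewrite gl_mulKV // => ->.
Qed.

Lemma core_conj x y : K x -> core y -> core (op (op (inv x) y) x).
Proof.
move=> Kx [Ky yP]; have Vx := KV Kx; have Kxy := KM Vx Ky.
split; first exact: KM.
move=> g Kg; have Kxg := KM Kx Kg; rewrite -KA // -KA //.
rewrite (lcoset_mul sH Vx (KM Ky Kxg) Kxg (yP _ Kxg)).
by rewrite gl_mulK.
Qed.

Lemma core_normal x : K x -> lcoset x core = [set op y x | y in core].
Proof.
move=> Kx; have Vx := KV Kx; apply/seteqP; split=> _ [y cy <-]; have Ky := cy.1.
  exists (op (op x y) (inv x)); last first.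
    by rewrite -KA ?KVx ?Kx1 //; exact: KM.
  by have := core_conj Vx cy; rewrite gl_invK.
exists (op (op (inv x) y) x); first exact: core_conj.
by rewrite -KA // gl_mulKV //; exact: KM.
Qed.

Lemma lcoset_core x y : K x -> K y ->
  (forall g, K g -> lcoset (op x g) H = lcoset (op y g) H) ->
  lcoset x core = lcoset y core.
Proof.
move=> Kx Ky xy; have Vx := KV Kx.
have cxy : core (op (inv x) y).
  split=> [|g Kg]; first exact: KM.
  rewrite -KA // -(lcoset_mul sH Vx _ _ (xy _ Kg)); try exact: KM.
  by rewrite gl_mulK.
apply/(lcoset_eqP subgroup_core Kx Ky); exact/(lcosetP subgroup_core).
Qed.

(** x core is determined by the action of x on the cosets of H, hence by the set
    of all tp g (op x g): if this set is the same for x and y then each g has a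
    g' with tp g (x g) = tp g' (y g'), so that g H = g' H and
    x g H = y g' H = y g H. *)
Lemma card_cosets_core (S : Type) (tp : T -> T -> S) :
  (forall g x g' x', K g -> K x -> K g' -> K x' -> tp g x = tp g' x' ->
     lcoset g H = lcoset g' H /\ lcoset x H = lcoset x' H) ->
  cosets op K core #<= [set: set S].
Proof.
move=> tpP.
have /choice[r rP] : forall C, exists x, cosets op K core C ->
    K x /\ lcoset x core = C.
  move=> C; have [[x Kx <-]|nC] := pselect (cosets op K core C).
    by exists x.
  by exists e.
apply: (@inj_card_le_fun _ _ _ _
  (fun C => [set tp g (op (r C) g) | g in K])) => //.
move=> C C'; rewrite !inE => /rP[Kr {2}<-] /rP[Kr' {2}<-] E.
apply: lcoset_core => // g Kg.
have [g' Kg' tE] : [set tp g (op (r C') g) | g in K] (tp g (op (r C) g)).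
  by rewrite -E; exists g.
have [||||gg' <-] := tpP _ _ _ _ _ _ _ _ tE => //; try exact: KM.
exact: (lcoset_mul sH).
Qed.

End Core.

End SetGroups.

(** * The second isomorphism theorem and homomorphisms *)

Section Normal.
Variables (T : Type) (op : T -> T -> T) (K : set T) (e : T) (inv : T -> T).
Hypothesis gl : group_laws op K e inv.

Lemma normal_subgroup_sub N H : subgroup op K H -> N `<=` H ->
  normal_subgroup op K N -> normal_subgroup op H N.
Proof.
move=> [HK _] NH [[_ gN] nN]; split=> [|x Hx]; first by split.
exact: nN (HK _ Hx).
Qed.

Lemma setop_lcoset N x y : normal_subgroup op K N -> K x -> K y ->
  setop op (lcoset op x N) (lcoset op y N) = lcoset op (op x y) N.
Proof.
move=> [sN nN] Kx Ky; have NK := sN.1.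
have gN := subgroup_laws gl sN.
apply/seteqP; split=> [_ [_ [h Nh <-]] [_ [k Nk <-]] <-|_ [k Nk <-]].
  have [h' Nh' hy] : lcoset op y N (op h y) by rewrite /lcoset nN //; exists h.
  have [[Kh Kk] Kh'] : (K h /\ K k) /\ K h' by do 2?split; exact: NK.
  have M := gl_mul gl; have A := gl_mulA gl.
  exists (op h' k); first exact: gl_mul gN _ _ _ _.
  rewrite -(A x y) ?(A y h' k) ?hy -?(A h y k) ?(A x h) //; exact: M.
exists x; first exact: (lcoset_mem gl sN Kx).
exists (op y k); first by exists k.
by rewrite (gl_mulA gl) //; exact: NK.
Qed.

End Normal.

Section SecondIsomorphism.
Variables (T : Type) (op : T -> T -> T) (K : set T) (e : T) (inv : T -> T).
Hypothesis gl : group_laws op K e inv.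
Variables H N A : set T.
Hypothesis sH : subgroup op K H.
Hypothesis sA : subgroup op K A.
Hypothesis nN : normal_subgroup op H N.
Hypothesis commA : forall a b, A a -> A b -> op a b = op b a.
Hypothesis repA : forall x, H x ->
  exists2 a, (H `&` A) a & lcoset op x N = lcoset op a N.

Let gH := subgroup_laws gl sH.
Let gA := subgroup_laws gl sA.
Let sN : subgroup op H N := nN.1.
Let gN := subgroup_laws gH sN.

Lemma subgroup_setIA X : subgroup op K X -> subgroup op K (X `&` A).
Proof.
move=> sX; have gX := subgroup_laws gl sX.
apply: (subgroup_of_closed gl).
- by move=> x [_ /sA.1].
- by split; [exact: gl_one gX|exact: gl_one gA].
- move=> x y [Xx Ax] [Xy Ay].
  by split; [exact: gl_mul gX _ _ _ _|exact: gl_mul gA _ _ _ _].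
- by move=> x [Xx Ax]; split; [exact: gl_inv gX _ _|exact: gl_inv gA _ _].
Qed.

Let sNK : subgroup op K N.
Proof. by split; [exact: subset_trans sN.1 sH.1|exact: sN.2]. Qed.
Let sHA := subgroup_setIA sH.
Let sNA := subgroup_setIA sNK.
Let gHA := subgroup_laws gl sHA.

Lemma normal_subgroup_setIA : normal_subgroup op (H `&` A) (N `&` A).
Proof.
split; first by split; [apply: setSI; exact: sN.1|exact: sNA.2].
move=> x [_ Ax]; apply/seteqP.
by split=> _ [y [Ny Ay] <-]; exists y => //; exact: commA.
Qed.

(** If a and a y are in A then so is y. *)
Lemma lcoset_setIA a : (H `&` A) a ->
  lcoset op a N `&` A = lcoset op a (N `&` A).
Proof.
move=> [Ha Aa]; apply/seteqP; split=> [_ [[y Ny <-] Aay]|_ [y [Ny Ay] <-]].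
  exists y => //; split=> //.
  rewrite -(gl_mulK gl (sH.1 _ Ha) (sNK.1 _ Ny)).
  by apply: gl_mul gA _ _ _ _ => //; exact: gl_inv gA _ _.
by split; [exists y|exact: gl_mul gA _ _ _ _].
Qed.

Lemma cosets_repA C : cosets op H N C ->
  exists2 a, (H `&` A) a & C = lcoset op a N.
Proof. by move=> [x Hx <-]; have [a HAa E] := repA Hx; exists a. Qed.

Lemma second_isomorphism :
  quotient_isomorphism op H N (H `&` A) (N `&` A) (setI^~ A).
Proof.
split; first split.
- by move=> C /cosets_repA[a HAa ->]; exists a => //; rewrite lcoset_setIA.
- move=> C D; rewrite !inE => /cosets_repA[a HAa ->] /cosets_repA[b HAb ->] E.
  have [Ha Aa] := HAa; have [Hb Ab] := HAb.
  apply/(lcoset_eqP gH sN Ha Hb).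
  have : (lcoset op b N `&` A) b by split => //; exact: (lcoset_mem gH sN Hb).
  by rewrite -E => -[].
- move=> _ [a HAa <-]; exists (lcoset op a N); last exact: lcoset_setIA.
  by exists a => //; exact: HAa.1.
move=> C D /cosets_repA[a HAa ->] /cosets_repA[b HAb ->].
rewrite (setop_lcoset gH nN HAa.1 HAb.1) !lcoset_setIA //.
  by rewrite (setop_lcoset gHA normal_subgroup_setIA).
exact: gl_mul gHA _ _ _ _.
Qed.

Lemma second_isomorphism_abelian : quotient_abelian op H N.
Proof.
move=> C D /cosets_repA[a [Ha Aa] ->] /cosets_repA[b [Hb Ab] ->].
by rewrite !(setop_lcoset gH nN) // commA.
Qed.

End SecondIsomorphism.

Section Homomorphism.
Variables (T : Type) (op : T -> T -> T) (K : set T) (e : T) (inv : T -> T).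
Variables (T' : Type) (op' : T' -> T' -> T') (K' : set T') (e' : T').
Variables (inv' : T' -> T') (pi : T -> T').
Hypothesis gl : group_laws op K e inv.
Hypothesis gl' : group_laws op' K' e' inv'.
Hypothesis piK : forall x, K x -> K' (pi x).
Hypothesis piM : forall x y, K x -> K y -> pi (op x y) = op' (pi x) (pi y).
Hypothesis pi_surj : forall y, K' y -> exists2 x, K x & pi x = y.

Lemma hom_one : pi e = e'.
Proof.
have Ke := gl_one gl; have K'e := piK Ke.
apply: (gl_mulI gl' K'e K'e (gl_one gl')).
by rewrite -piM // (gl_1mul gl) // (gl_mul1 gl').
Qed.

Lemma hom_inv x : K x -> pi (inv x) = inv' (pi x).
Proof.
move=> Kx; have Vx := gl_inv gl Kx.
apply: (gl_mulI gl' (piK Kx) (piK Vx) (gl_inv gl' (piK Kx))).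
by rewrite -piM // (gl_mulV gl) // (gl_mulV gl') ?hom_one //; exact: piK.
Qed.

Definition hom_preimage (H' : set T') : set T := [set x | K x /\ H' (pi x)].

Lemma subgroup_preimage H' :
  subgroup op' K' H' -> subgroup op K (hom_preimage H').
Proof.
move=> sH'; have gH' := subgroup_laws gl' sH'.
apply: (subgroup_of_closed gl).
- by move=> x [].
- by split; [exact: gl_one gl|rewrite hom_one; exact: gl_one gH'].
- move=> x y [Kx Hx] [Ky Hy]; split; first exact: gl_mul gl _ _ _ _.
  by rewrite piM //; exact: gl_mul gH' _ _ _ _.
- move=> x [Kx Hx]; split; first exact: gl_inv gl _ _.
  by rewrite hom_inv //; exact: gl_inv gH' _ _.
Qed.

(** Taking images under pi is injective on cosets of a preimage. *)
Lemma card_cosets_preimage H' : subgroup op' K' H' ->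
  cosets op K (hom_preimage H') #<= cosets op' K' H'.
Proof.
move=> sH'; have sP := subgroup_preimage sH'.
have imE x : K x ->
    pi @` lcoset op x (hom_preimage H') = lcoset op' (pi x) H'.
  move=> Kx; apply/seteqP; split=> [_ [_ [y [Ky Hy] <-] <-]|_ [y Hy <-]].
    by rewrite piM //; exists (pi y).
  have [u Ku uy] := pi_surj (sH'.1 _ Hy).
  exists (op x u); last by rewrite piM // uy.
  by exists u => //; split=> //; rewrite uy.
apply: (@inj_card_le_fun _ _ _ _ (image^~ pi)).
  by move=> _ [x Kx <-]; rewrite imE //; exists (pi x) => //; exact: piK.
move=> C D; rewrite !inE => -[x Kx <-] [y Ky <-].
rewrite !imE // => /(lcoset_eqP gl' sH' (piK Kx) (piK Ky)).
move=> /(lcosetP gl' sH' (piK Kx) (piK Ky)) E.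
apply/(lcoset_eqP gl sP Kx Ky)/(lcosetP gl sP Kx Ky).
have Vx := gl_inv gl Kx; split; first exact: gl_mul gl _ _ _ _.
by rewrite piM // hom_inv.
Qed.

Lemma subgroup_image H : subgroup op K H -> subgroup op' K' (pi @` H).
Proof.
move=> sH; have gH := subgroup_laws gl sH; have HK := sH.1.
apply: (subgroup_of_closed gl').
- by move=> _ [x Hx <-]; apply: piK; exact: HK.
- by exists e; [exact: gl_one gH|exact: hom_one].
- move=> _ _ [x Hx <-] [y Hy <-].
  exists (op x y); first exact: gl_mul gH _ _ _ _.
  by rewrite piM //; exact: HK.
- move=> _ [x Hx <-]; exists (inv x); first exact: gl_inv gH _ _.
  by rewrite hom_inv //; exact: HK.
Qed.

Lemma card_cosets_image H : H `<=` K ->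
  cosets op' K' (pi @` H) #<= cosets op K H.
Proof.
move=> HK; apply: (@surj_card_le_fun _ _ _ _ (image^~ pi)).
move=> _ [_ /pi_surj[x Kx <-] <-]; exists (lcoset op x H); first by exists x.
apply/seteqP; split=> [_ [_ [y Hy <-] <-]|_ [_ [y Hy <-] <-]].
  by exists (pi y); [exists y|rewrite piM //; exact: HK].
by exists (op x y); [exists y|rewrite piM //; exact: HK].
Qed.

End Homomorphism.

(** * The group defined by a cocycle *)

Section ExtensionGroup.
Variables (T : Type) (n m : nat) (D : ext_data T n m).
Hypothesis gG : is_group (gmul D) (grp D).
Hypothesis gA : is_abelian_group (aadd D) (abg D).
Hypothesis acD : acts_by_automorphisms D.
Hypothesis coD : is_2cocycle D.

Lemma joinE (x : 'I_m + 'I_n -> T) : join (x \o inl) (x \o inr) = x.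
Proof. by apply/funext => -[]. Qed.

Lemma ext_carrierP x :
  ext_carrier D x <-> abg D (x \o inl) /\ grp D (x \o inr).
Proof.
split=> [[a Aa [g Gg <-]]//|[Aa Gg]].
by exists (x \o inl) => //; exists (x \o inr) => //; exact: joinE.
Qed.

(** A is the kernel of the projection to G. *)
Lemma ext_abgP e x : is_unit (gmul D) (grp D) e ->
  ext_abg D x <-> abg D (x \o inl) /\ x \o inr = e.
Proof.
move=> ue; split=> [[a Aa [e' [Ge' ue'] <-]]|[Aa xe]].
  by split=> //; change (e' = e); rewrite -(ue' _ ue.1).1 (ue.2 _ Ge').2.
by exists (x \o inl) => //; exists e => //; rewrite -xe joinE.
Qed.

Lemma ext_mul_join a b g h :
  ext_mul D (join a g) (join b h) =
  join (aadd D (aadd D a (act D g b)) (coc D g h)) (gmul D g h).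
Proof. by []. Qed.

(** The cocycle equation is associativity of the product, and the normalization
    of the cocycle makes (0, e) a left unit. *)
Lemma ext_is_group : is_group (ext_mul D) (ext_carrier D).
Proof.
have [acl aadd_ amul aone] := acD; have [ccl ceq cone] := coD.
have [e [inv glG]] := group_laws_exist gG.
have [z [opp glA]] := group_laws_exist gA.1; have addC := gA.2.
have ue : is_unit (gmul D) (grp D) e.
  by split=> [|x Gx]; [exact: gl_one glG|rewrite (gl_1mul glG) ?(gl_mul1 glG)].
have uz : is_unit (aadd D) (abg D) z.
  by split=> [|x Gx]; [exact: gl_one glA|rewrite (gl_1mul glA) ?(gl_mul1 glA)].
have GM := gl_mul glG; have AM := gl_mul glA; have AA := gl_mulA glA.
have rot a b c : abg D a -> abg D b -> abg D c ->
    aadd D (aadd D a b) c = aadd D (aadd D a c) b.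
  by move=> Aa Ab Ac; rewrite -!AA // (addC b c).
apply: (@left_group_is_group _ _ _ (join z e)).
- move=> _ _ [a Aa [g Gg <-]] [b Ab [h Gh <-]].
  rewrite ext_mul_join; apply/ext_carrierP; split; last exact: GM.
  by apply: (AM); [apply: (AM) => //; exact: acl|exact: ccl].
- move=> _ _ _ [a1 A1 [g1 G1 <-]] [a2 A2 [g2 G2 <-]] [a3 A3 [g3 G3 <-]].
  rewrite !ext_mul_join (gl_mulA glG) //; congr (join _ _).
  have C12 := ccl _ _ G1 G2; have C23 := ccl _ _ G2 G3.
  have C12_3 := ccl _ _ (GM _ _ G1 G2) G3.
  have C1_23 := ccl _ _ G1 (GM _ _ G2 G3).
  have B2 := acl _ _ G1 A2; have B3 := acl _ _ G2 A3.
  have B3' := acl _ _ G1 B3; have D23 := acl _ _ G1 C23.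
  rewrite aadd_ //; last exact: AM.
  rewrite aadd_ // amul //; move: (ceq _ _ _ G1 G2 G3).
  (* What remains is an identity between sums in A, with the cocycle equation
     as E; the summands are replaced by variables. *)
  move: (act D g1 a2) (act D g1 (act D g2 a3)) (act D g1 (coc D g2 g3))
    (coc D g1 g2) (coc D (gmul D g1 g2) g3) (coc D g1 (gmul D g2 g3))
    B2 B3' D23 C12 C12_3 C1_23 => b2 b3 d c12 c3 c1 B2 B3' Dd C12 C3 C1 E.
  have P2 := AM _ _ A1 B2; have P3 := AM _ _ P2 B3'.
  rewrite (rot _ c12 b3) // -(AA _ c12 c3) // E (addC c1) // !AA //.
    exact: AM.
- by apply/ext_carrierP; split; [exact: uz.1|exact: ue.1].
- move=> _ [a Aa [g Gg <-]]; rewrite ext_mul_join (gl_1mul glG) // aone //.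
  by rewrite (cone _ _ _ ue uz Gg).2 (gl_1mul glA) // (gl_mul1 glA).
- move=> _ [a Aa [g Gg <-]].
  have Vg := gl_inv glG Gg; have Ca := acl _ _ Vg Aa; have Cg := ccl _ _ Vg Gg.
  have Vs := gl_inv glA (AM _ _ Ca Cg).
  exists (join (opp (aadd D (act D (inv g) a) (coc D (inv g) g))) (inv g)).
    exact/ext_carrierP.
  rewrite ext_mul_join (gl_Vmul glG) // -AA // (gl_Vmul glA) //.
  exact: AM.
Qed.

Lemma ext_abg_mulC x y : ext_abg D x -> ext_abg D y ->
  ext_mul D x y = ext_mul D y x.
Proof.
have [_ _ _ aone] := acD; have [_ _ cone] := coD.
have [_ _ [e ue _]] := gG; have [[_ _ [z uz _]] addC] := gA.
move=> /(ext_abgP _ ue)[Ax xe] /(ext_abgP _ ue)[Ay ye].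
rewrite /ext_mul xe ye; congr (join _ _).
by rewrite !aone // (addC (x \o inl)).
Qed.

End ExtensionGroup.

(** * Bounded invariant maps depend only on the type over the small model *)

Lemma filter_finite_bigI I T (F : set_system T) (q : set I) (S : I -> set T) :
  Filter F -> finite_set q -> (forall i, q i -> F (S i)) ->
  F (\bigcap_(i in q) S i).
Proof.
elim/Pchoice: I => I in q S *.
by move=> FF /finite_fsetP[X ->] qS; exact: filter_bigI.
Qed.

Section Types.
Variables (L : language) (M N : structure L) (iota : M -> N).
Hypothesis el : elementary_embedding iota.
Variable V : finType.

Lemma elementary_sat W (phi : formula L W) (e : W -> M) :
  sat phi (iota \o e) <-> sat phi e.
Proof.
by have := el (frename e phi); rewrite !sat_rename => <-.
Qed.

(** The formulas satisfied by a over M define nonempty sets of tuples of M, by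
    elementarity, and are closed under conjunction: they generate a proper
    filter. *)
Lemma coheir_exists (a : V -> N) :
  exists U : set_system (V -> M), UltraFilter U /\
    forall phi : formula L (V + M),
      sat phi (join a iota) -> U [set u | sat phi (join u id)].
Proof.
pose F := filter_from [set phi : formula L (V + M) | sat phi (join a iota)]
  (fun phi => [set u : V -> M | sat phi (join u id)]).
have FF : ProperFilter F.
  apply: filter_from_proper.
    apply: filter_from_filter.
      by exists (Fnot (Fbot _ _)).
    move=> p q /= pa qa; exists (Fand p q); first by apply/sat_and.
    by move=> u /sat_and.
  move=> p /= pa; have [q qP] := exists_tuple_definable p.
  have : sat q iota by apply/qP; exists a.
  by rewrite -el => /qP[u uP]; exists u.
have [U [UU FU]] := ultraFilterLemma FF.
by exists U; split=> // p pa; apply: FU; exists p.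
Qed.

(** The average of the ultrafilter U is the global type of the formulas that
    hold for U-almost all tuples of M; d realizes its restriction to the
    parameters e. *)
Definition realizes_average (U : set_system (V -> M)) W (e : W -> N)
    (d : V -> N) : Prop :=
  forall phi : formula L (V + W),
    U [set u | sat phi (join (iota \o u) e)] -> sat phi (join d e).

Lemma realizes_average_iff U W (e : W -> N) d :
  UltraFilter U -> realizes_average U e d ->
  forall phi : formula L (V + W),
    U [set u | sat phi (join (iota \o u) e)] <-> sat phi (join d e).
Proof.
move=> UU dU phi; split; first exact: dU.
move=> dphi; have [//|nphi] :=
  in_ultra_setVsetC [set u | sat phi (join (iota \o u) e)] UU.
by have := dU (Fnot phi) nphi; move/(_ dphi).
Qed.

Lemma realizes_average_sub U W W' (w : W' -> W) (e : W -> N) d :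
  Filter U -> realizes_average U e d -> realizes_average U (e \o w) d.
Proof.
move=> FU dU phi; pose r (s : V + W') : V + W :=
  match s with inl v => inl v | inr i => inr (w i) end.
have E x : join x (e \o w) = join x e \o r by apply/funext => -[].
by rewrite E -sat_rename => H; apply: dU; apply: filterS H => u /=;
  rewrite E sat_rename.
Qed.

Lemma realizes_average_exists kappa U W (e : W -> N) :
  saturated kappa N -> small kappa (range e) -> ProperFilter U ->
  exists d, realizes_average U e d.
Proof.
move=> sat_N sm UU.
have eP w : (range e) (e w) by exists w.
pose r (s : V + W) : V + range e :=
  match s with inl v => inl v | inr w => inr (SigSub (mem_set (eP w))) end.
have E x : join x e = join x (@set_val N (range e)) \o r.
  by apply/funext => -[].
have [q qfin qU|d dP] := sat_N _ sm V [set phi | U [set u : V -> M |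
    sat phi (join (iota \o u) (@set_val N (range e)))]].
  have /filter_ex[u uP] : U (\bigcap_(phi in q)
      [set u : V -> M | sat phi (join (iota \o u) (@set_val N (range e)))]).
    exact: filter_finite_bigI.
  by exists (iota \o u).
exists d => phi H; rewrite E -sat_rename; apply: dP.
by apply: filterS H => u /=; rewrite E sat_rename.
Qed.

(** The average type is invariant over M: whether a formula phi(x, a, c) belongs
    to it depends on which tuples u of M satisfy phi(u, a, c), and so on a only
    through its type over M. *)
Lemma realizes_average_invariant (P : Type) (c : P -> M) U (a b d d' : V -> N) :
  UltraFilter U -> same_type (join a iota) (join b iota) ->
  realizes_average U (join a (iota \o c)) d ->
  realizes_average U (join b (iota \o c)) d' ->
  same_type (join d (join a (iota \o c))) (join d' (join b (iota \o c))).
Proof.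
move=> UU ab da d'b phi.
rewrite -(realizes_average_iff UU da) -(realizes_average_iff UU d'b).
suff -> : [set u | sat phi (join (iota \o u) (join a (iota \o c)))] =
          [set u | sat phi (join (iota \o u) (join b (iota \o c)))] by [].
apply/funext => u; apply/propext => /=.
pose r (s : V + (V + P)) : V + M :=
  match s with inl v => inr (u v) | inr (inl v) => inl v
             | inr (inr p) => inr (c p) end.
have E x : join (iota \o u) (join x (iota \o c)) = join x iota \o r.
  by apply/funext => -[|[]].
by rewrite !E -!sat_rename; exact: ab.
Qed.

Lemma small_coordinates kappa U (A : set U) (g : U -> V -> N) :
  infinite_set [set: kappa] -> small kappa A ->
  small kappa [set y | exists v, exists2 u, A u & g u v = y].
Proof.
move=> kinf smA.
suff H (s : seq V) :
    small kappa [set y | exists2 v, v \in s & exists2 u, A u & g u v = y].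
  apply: card_le_small (H (enum V)); apply: subset_card_le => y [v vP].
  by exists v => //; rewrite mem_enum.
elim: s => [|v s IH].
  by apply: finite_small => //; apply: sub_finite_set (finite_set0 _) => y [].
apply: (@card_le_small _ _ _ _ ((g^~ v @` A) `|`
  [set y | exists2 v, v \in s & exists2 u, A u & g u v = y])).
  apply: subset_card_le => y [w]; rewrite inE => /orP[/eqP ->|ws] wP.
    by left.
  by right; exists w.
apply: small_setU => //.
by apply: card_le_small smA; exact: card_image_le.
Qed.

End Types.

Section Bounded.
Variables (L : language) (M N : structure L) (iota : M -> N) (kappa : Type).
Variables (P : Type) (c : P -> M) (V : finType).
Hypothesis mon : monster kappa iota.
Hypothesis Pfin : finite_set [set: P].

(** The formulas x_k = x_k are infinitely many. *)
Lemma monster_infinite : infinite_set [set: kappa].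
Proof.
have [/andP[le _] _ _ _] := mon; apply/infiniteP; apply: card_le_trans le.
pose v k : formula L (nat + M) := Feq (Var _ (inl k)) (Var _ (inl k)).
apply: (@inj_card_le_fun _ _ _ _ (fun k => [set [set v k]])) => // i j _ _ E.
have : [set [set v i]] [set v i] by [].
rewrite E => {}E; have : [set v i] (v i) by [].
by rewrite E => -[].
Qed.

Lemma monster_small_base : small kappa [set: M].
Proof.
have [+ _ _ _] := mon; apply: card_le_small.
pose v k : formula L (nat + M) := Feq (Var _ (inr k)) (Var _ (inr k)).
apply: (@inj_card_le_fun _ _ _ _ (fun k => [set [set v k]])) => // i j _ _ E.
have : [set [set v i]] [set v i] by [].
rewrite E => {}E; have : [set v i] (v i) by [].
by rewrite E => -[].
Qed.

Lemma finite_range_join A B (f : A -> N) (g : B -> N) :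
  finite_set (range f) -> finite_set (range g) -> finite_set (range (join f g)).
Proof.
move=> ff gf; apply: (@sub_finite_set _ _ (range f `|` range g)); last first.
  by rewrite finite_setU.
by move=> _ [[a|b] _ <-]; [left; exists a|right; exists b].
Qed.

Lemma finite_automorphism W (e e' : W -> N) :
  finite_set (range e) -> same_type e e' ->
  exists s, automorphism s /\ s \o e = e'.
Proof.
move=> fe; have [_ _ _ hom] := mon; apply: homogeneous_automorphism hom _.
exact: finite_small monster_infinite fe.
Qed.

(** An equivalence relation invariant over c and with boundedly many classes is
    coarser than equality of types over M.  The relation is given as the kernel
    of f, and the bound is on the values of f. *)
Lemma bounded_map_type (X : set (V -> N)) U (f : (V -> N) -> U) :
  Defs.invariant (iota \o c) X ->
  (forall s, automorphism_over (iota \o c) s -> forall x y, X x -> X y ->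
     f x = f y -> f (s \o x) = f (s \o y)) ->
  small kappa (f @` X) ->
  forall a b, X a -> X b -> same_type (join a iota) (join b iota) -> f a = f b.
Proof.
move=> Xinv finv fsm a b Xa Xb ab.
have [_ el satN _] := mon.
have kinf := monster_infinite.
have fV (W : finType) (x : W -> N) : finite_set (range x).
  by apply: finite_image; exact: finite_finset.
have fc : finite_set (range (iota \o c)) by exact: finite_image.
have [ul [UU ulP]] := coheir_exists el a.
pose Y := [set x | X x /\ same_type (join a iota) (join x iota)].
have Ya : Y a by split.
have Yb : Y b by split.
have /choice[g gP] : forall w, exists x, (f @` Y) w -> Y x /\ f x = w.
  move=> w; have [[x Yx <-]|nw] := pselect ((f @` Y) w); first by exists x.
  by exists a.
(* The parameters are M and the coordinates of one representative for each value
   of f on the realizations of the type of a. *)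
pose e (s : M + (V * (f @` Y))) : N :=
  match s with inl i => iota i | inr p => g (set_val p.2) p.1 end.
have [d dP] : exists d, realizes_average iota ul e d.
  apply: realizes_average_exists satN _ _ => //.
  apply: (@card_le_small _ _ _ _ (range iota `|`
    [set y | exists v, exists2 w, (f @` Y) w & g w v = y])).
    apply: subset_card_le => _ [[i|[v w]] _ <-]; [by left; exists i|].
    by right; exists v; exists (set_val w) => //; exact: set_valP.
  apply: small_setU => //.
    by apply: card_le_small monster_small_base; exact: card_image_le.
  apply: small_coordinates => //; apply: card_le_small fsm.
  by apply: subset_card_le => _ [x [Xx _] <-]; exists x.
have dM : realizes_average iota ul iota d.
  exact: (realizes_average_sub (w := inl) _ dP).
(* d realizes the type of a over M, so f d is the value of a representative. *)
have ad : same_type (join a iota) (join d iota).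
  have H (phi : formula L (V + M)) :
      sat phi (join a iota) -> sat phi (join d iota).
    move=> /ulP aphi; apply: dM; apply: filterS aphi => u /=.
    rewrite -(elementary_sat el); congr (sat phi _).
    by apply/funext => -[].
  move=> phi; split; first exact: H.
  move=> dphi; apply: contrapT => naphi; exact: (H (Fnot phi) naphi dphi).
have Xd : X d.
  have adc : same_type (join a (iota \o c)) (join d (iota \o c)).
    move=> phi; pose r (s : V + P) : V + M :=
      match s with inl v => inl v | inr p => inr (c p) end.
    have E x : join x (iota \o c) = join x iota \o r by apply/funext => -[].
    by rewrite !E -!sat_rename.
  have [s [sA sE]] := finite_automorphism (finite_range_join (fV _ _) fc) adc.
  have -> : d = s \o a.
    by apply/funext => v; have /= -> := congr1 (@^~ (inl v)) sE.
  apply: Xinv => //; split=> // p.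
  by have := congr1 (@^~ (inr p)) sE.
have Yd : Y d by split.
have fYd : (f @` Y) (f d) by exists d.
have [[Xr ar] fr] := gP _ fYd.
set r := g (f d) in Xr ar fr.
have dr : realizes_average iota ul (join r (iota \o c)) d.
  have -> : join r (iota \o c) = e \o (fun s : V + P =>
      match s with inl v => inr (v, SigSub (mem_set fYd))
                 | inr p => inl (c p) end).
    by apply/funext => -[].
  exact: realizes_average_sub.
(* The pair (r, d) can be moved to (x, d') by an automorphism over c. *)
have main x d' : Y x -> realizes_average iota ul (join x (iota \o c)) d' ->
    f x = f d'.
  move=> [Xx ax] d'x.
  have rx : same_type (join r iota) (join x iota).
    by move=> phi; rewrite -(ar phi) (ax phi).
  have [|s [sA sE]] := finite_automorphism _
    (realizes_average_invariant UU rx dr d'x).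
    exact: finite_range_join (fV _ _) (finite_range_join (fV _ _) fc).
  have -> : x = s \o r.
    by apply/funext => v; have /= -> := congr1 (@^~ (inr (inl v))) sE.
  have -> : d' = s \o d.
    by apply/funext => v; have /= -> := congr1 (@^~ (inl v)) sE.
  apply: finv => //; split=> // p.
  by have := congr1 (@^~ (inr (inr p))) sE.
have [d' d'P] : exists d',
    realizes_average iota ul (join (join a b) (iota \o c)) d'.
  apply: realizes_average_exists satN _ _ => //.
  apply: finite_small => //.
  exact: finite_range_join (finite_range_join (fV _ _) (fV _ _)) fc.
rewrite (main a d') //; first rewrite (main b d') //.
  have -> : join b (iota \o c) = join (join a b) (iota \o c) \o
    (fun s : V + P => match s with inl v => inl (inr v) | inr p => inr p end).
    by apply/funext => -[].
  exact: realizes_average_sub.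
have -> : join a (iota \o c) = join (join a b) (iota \o c) \o
  (fun s : V + P => match s with inl v => inl (inl v) | inr p => inr p end).
  by apply/funext => -[].
exact: realizes_average_sub.
Qed.

End Bounded.

(** * Invariant groups in a monster model *)

Lemma type_definable_invariant (L : language) (N : structure L) (P : Type)
    (c : P -> N) (V : finType) (X : set (V -> N)) :
  type_definable c X -> Defs.invariant c X.
Proof.
move=> [p ->] s [sA sc] x xp phi /xp; rewrite (sat_automorphism _ _ sA).
congr (sat phi _); by apply/funext => -[v|q] //=.
Qed.

(** Counts the types of V-tuples over M by sets of formulas in variables indexed
    by nat, the measure in which the size of kappa is expressed. *)
Lemma type_code (L : language) (M N : structure L) (iota : M -> N)
    (V : finType) :
  exists tp : (V -> N) -> set (formula L (nat + M)),
    forall x y, tp x = tp y -> same_type (join x iota) (join y iota).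
Proof.
have [[d]|N0] := pselect (inhabited N); last first.
  exists (fun=> set0) => x y _; suff -> : x = y by [].
  by apply/funext => v; case: N0; exists; exact: (x v).
pose ext (x : V -> N) k := oapp x d (unpickle k).
(* ext x spreads the tuple x over variables indexed by nat, and fills the
   remaining ones with the default value d. *)
exists (fun x => [set phi | sat phi (join (ext x) iota)]) => x y xy phi.
pose r (s : V + M) : nat + M :=
  match s with inl v => inl (pickle v) | inr i => inr i end.
have E u : join u iota = join (ext u) iota \o r.
  by apply/funext => -[v|//] /=; rewrite /ext pickleK.
rewrite !E -!sat_rename.
have : [set phi | sat phi (join (ext x) iota)] (frename r phi) <->
       [set phi | sat phi (join (ext y) iota)] (frename r phi) by rewrite xy.
exact.
Qed.

Section InvariantGroup.
Variables (L : language) (N : structure L) (P : Type) (c : P -> N).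
Variables (V : finType) (op : (V -> N) -> (V -> N) -> (V -> N)).
Variables (K : set (V -> N)) (e : V -> N) (inv : (V -> N) -> V -> N).
Hypothesis gl : group_laws op K e inv.
Hypothesis Kinv : Defs.invariant c K.
Hypothesis opinv : forall s, automorphism_over c s ->
  forall x y, K x -> K y -> s \o op x y = op (s \o x) (s \o y).

Lemma lcoset_invariant H s x y : subgroup op K H -> Defs.invariant c H ->
  automorphism_over c s -> K x -> K y ->
  lcoset op x H = lcoset op y H ->
  lcoset op (s \o x) H = lcoset op (s \o y) H.
Proof.
move=> sH Hinv sc Kx Ky /(lcoset_eqP gl sH Kx Ky)[h Hh <-].
have Kxh : K (op x h) by apply: gl_mul gl _ _ _ _ => //; exact: sH.1.
apply/(lcoset_eqP gl sH); try exact: Kinv.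
exists (s \o h); first exact: Hinv.
by rewrite opinv //; exact: sH.1.
Qed.

Lemma core_invariant H : subgroup op K H -> Defs.invariant c H ->
  Defs.invariant c (core op K H).
Proof.
move=> sH Hinv s sc x [Kx xP]; split; first exact: Kinv.
move=> g Kg; have [s' [s'c sK s'K]] := automorphism_over_inv sc.
have -> : g = s \o (s' \o g) by apply/funext => v /=; rewrite s'K.
have Kg' : K (s' \o g) by exact: Kinv.
rewrite -opinv //; apply: lcoset_invariant => //.
  exact: gl_mul gl _ _ _ _.
exact: xP.
Qed.

End InvariantGroup.

(** By minimality H is contained in its core, once the core is known to be
    invariant and of bounded index; and the core is normal. *)
Lemma comp000_normal (L : language) (M N : structure L) (iota : M -> N)
    (kappa P : Type) (c : P -> M) (V : finType)
    (op : (V -> N) -> (V -> N) -> (V -> N)) (K H : set (V -> N)) :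
  monster kappa iota -> finite_set [set: P] -> is_group op K ->
  Defs.invariant (iota \o c) K ->
  (forall s, automorphism_over (iota \o c) s ->
    forall x y, K x -> K y -> s \o op x y = op (s \o x) (s \o y)) ->
  is_comp000 kappa (iota \o c) op K H -> normal_subgroup op K H.
Proof.
move=> mon Pfin gK Kinv opinv [[sH Hbd Hinv] Hmin].
have [e [inv gl]] := group_laws_exist gK.
have [tp tpP] := type_code iota (V + V)%type.
have Hc : H `<=` core op K H.
  apply: Hmin; split.
  - exact: subgroup_core gl _.
  - have [big _ _ _] := mon; apply: card_le_small big.
    apply: (card_cosets_core gl sH (tp := fun g x => tp (join g x))).
    move=> g x g' x' Kg Kx Kg' Kx' /tpP E.
    have st : forall y y', K y -> K y' ->
        same_type (join y iota) (join y' iota) ->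
        lcoset op y H = lcoset op y' H.
      apply: (bounded_map_type mon Pfin Kinv) => // s sc y y' Ky Ky'.
      exact: lcoset_invariant gl Kinv opinv _ _ _ _ sH Hinv sc Ky Ky'.
    split; apply: st => // phi.
      pose r (s : V + M) : (V + V) + M :=
        match s with inl v => inl (inl v) | inr i => inr i end.
      have Er (y y' : V -> N) : join y iota = join (join y y') iota \o r.
        by apply/funext => -[].
      by rewrite (Er g x) (Er g' x') -!sat_rename.
    pose r (s : V + M) : (V + V) + M :=
      match s with inl v => inl (inr v) | inr i => inr i end.
    have Er (y y' : V -> N) : join y' iota = join (join y y') iota \o r.
      by apply/funext => -[].
    by rewrite (Er g x) (Er g' x') -!sat_rename.
  - exact: core_invariant gl Kinv opinv _ sH Hinv.
have <- : core op K H = H by apply/seteqP; split=> //; exact: (core_sub gl sH).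
split; first exact: subgroup_core gl _.
by move=> x Kx; exact: (core_normal gl sH Kx).
Qed.

(** * Automorphisms and the extension group *)

Section InterpretedExtension.
Variables (L : language) (N : structure L) (P : Type) (n m : nat).
Variables (c : P -> N) (F : ext_formulas L P n m) (D : ext_data N n m).
Hypothesis FD : interprets c F D.

Section Automorphism.
Variable s : N -> N.
Hypothesis sc : automorphism_over c s.

Let s_join V W (x : V -> N) (y : W -> N) :
  s \o join x y = join (s \o x) (s \o y).
Proof. by apply/funext => -[]. Qed.

Lemma grp_invariant g : grp D g -> grp D (s \o g).
Proof.
by move=> /FD.1 Gg; apply/FD.1; rewrite -(sat_automorphism _ _ sc.1).
Qed.

Lemma abg_invariant g : abg D g -> abg D (s \o g).
Proof.
by move=> /FD.2.1 Gg; apply/FD.2.1; rewrite -(sat_automorphism _ _ sc.1).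
Qed.

Lemma gmul_invariant x y : grp D x -> grp D y ->
  s \o gmul D x y = gmul D (s \o x) (s \o y).
Proof.
move=> Gx Gy; apply/esym/FD.2.2.1; try exact: grp_invariant.
by rewrite -!s_join -(sat_automorphism _ _ sc.1) -FD.2.2.1.
Qed.

Lemma aadd_invariant x y : abg D x -> abg D y ->
  s \o aadd D x y = aadd D (s \o x) (s \o y).
Proof.
move=> Gx Gy; apply/esym/FD.2.2.2.1; try exact: abg_invariant.
by rewrite -!s_join -(sat_automorphism _ _ sc.1) -FD.2.2.2.1.
Qed.

Lemma act_invariant x y : grp D x -> abg D y ->
  s \o act D x y = act D (s \o x) (s \o y).
Proof.
move=> Gx Gy; apply/esym/FD.2.2.2.2.1;
  [exact: grp_invariant|exact: abg_invariant|].
by rewrite -!s_join -(sat_automorphism _ _ sc.1) -FD.2.2.2.2.1.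
Qed.

Lemma coc_invariant x y : grp D x -> grp D y ->
  s \o coc D x y = coc D (s \o x) (s \o y).
Proof.
move=> Gx Gy; apply/esym/FD.2.2.2.2.2; try exact: grp_invariant.
have cE : s \o c = c by apply/funext => p; exact: sc.2.
rewrite -[in X in sat _ X]cE -!s_join -(sat_automorphism _ _ sc.1).
by rewrite -FD.2.2.2.2.2.
Qed.

End Automorphism.

Lemma ext_carrier_invariant : Defs.invariant c (ext_carrier D).
Proof.
move=> s sc x /ext_carrierP[Ax Gx]; apply/ext_carrierP.
by split; [exact: (abg_invariant sc Ax)|exact: (grp_invariant sc Gx)].
Qed.

Hypothesis gG : is_group (gmul D) (grp D).
Hypothesis gA : is_abelian_group (aadd D) (abg D).
Hypothesis acD : acts_by_automorphisms D.
Hypothesis coD : is_2cocycle D.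

Lemma ext_mul_invariant s : automorphism_over c s ->
  forall x y, ext_carrier D x -> ext_carrier D y ->
  s \o ext_mul D x y = ext_mul D (s \o x) (s \o y).
Proof.
move=> sc x y /ext_carrierP[Ax Gx] /ext_carrierP[Ay Gy].
have [acl _ _ _] := acD; have [ccl _ _] := coD; have [[Acl _ _] _] := gA.
rewrite -[LHS]joinE /ext_mul; congr (join _ _); last first.
  exact: (gmul_invariant sc Gx Gy).
transitivity (s \o aadd D (aadd D (x \o inl) (act D (x \o inr) (y \o inl)))
  (coc D (x \o inr) (y \o inr))); first by [].
have Aa := acl _ _ Gx Ay.
rewrite (aadd_invariant sc) ?(aadd_invariant sc) ?(act_invariant sc)
  ?(coc_invariant sc) //.
- exact: Acl.
- exact: ccl.
Qed.

Lemma ext_abg_invariant : Defs.invariant c (ext_abg D).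
Proof.
move=> s sc x; have [e [inv gl]] := group_laws_exist gG.
have Ge := gl_one gl.
have ue : is_unit (gmul D) (grp D) e.
  by split=> // y Gy; rewrite (gl_1mul gl) ?(gl_mul1 gl).
move=> /(ext_abgP _ ue)[Ax xe]; apply/(ext_abgP _ ue).
split; first exact: (abg_invariant sc Ax).
transitivity (s \o e); first by rewrite -xe.
have Gse := grp_invariant sc Ge.
apply: (gl_mulI gl Gse Gse Ge).
by rewrite -(gmul_invariant sc) // (gl_1mul gl) // (gl_mul1 gl).
Qed.

Lemma type_definable_preimage H : type_definable c H ->
  type_definable c (hom_preimage (ext_carrier D) (fun x => x \o inr) H).
Proof.
move=> [p ->].
pose r (s : 'I_n + P) : ('I_m + 'I_n) + P :=
  match s with inl j => inl (inr j) | inr i => inr i end.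
have E (x : 'I_m + 'I_n -> N) : join (x \o inr) c = join x c \o r.
  by apply/funext => -[].
exists ([set frename (inl \o inl) (f_abg F); frename (inl \o inr) (f_grp F)]
  `|` frename r @` p).
apply/seteqP; split=> x.
  move=> [/ext_carrierP[/FD.2.1 Ax /FD.1 Gx] xp] _ [[->|->]|[phi pphi <-]].
  - by rewrite sat_rename.
  - by rewrite sat_rename.
  - by rewrite sat_rename -E; exact: xp.
move=> H0; split.
  apply/ext_carrierP; split; [apply/FD.2.1|apply/FD.1].
    have := H0 (frename (inl \o inl) (f_abg F)); rewrite sat_rename.
    by apply; left; left.
  have := H0 (frename (inl \o inr) (f_grp F)); rewrite sat_rename.
  by apply; left; right.
move=> phi pphi; rewrite E -sat_rename; apply: H0.
by right; exists phi.
Qed.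

End InterpretedExtension.

(** * The isomorphism *)

Theorem proposition2p14
  (L : language) (M : structure L) (n m : nat)
  (B : set M) (F : ext_formulas L B n m) (D : ext_data M n m)
  (kappa : Type) (Ms : structure L) (iota : M -> Ms)
  (Ds : ext_data Ms n m)
  (G00 G000 : set ('I_n -> Ms)) (N00 N000 : set ('I_m + 'I_n -> Ms)) :
  let b : B -> Ms := iota \o @set_val M B in
  let A := ext_abg Ds in
  let op := ext_mul Ds in
  finite_set B ->
  interprets (@set_val M B) F D ->
  is_group (gmul D) (grp D) ->
  is_abelian_group (aadd D) (abg D) ->
  acts_by_automorphisms D ->
  is_2cocycle D ->
  finite_set (coc_image D) ->
  (forall a, coc_image D a -> forall i, dcl B (a i)) ->
  monster kappa iota ->
  interprets b F Ds ->
  is_comp00 kappa b (gmul Ds) (grp Ds) G00 ->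
  is_comp000 kappa b (gmul Ds) (grp Ds) G000 ->
  is_comp00 kappa b op (ext_carrier Ds) N00 ->
  is_comp000 kappa b op (ext_carrier Ds) N000 ->
  G000 = G00 ->
  [/\ normal_subgroup op N00 N000,
      normal_subgroup op (N00 `&` A) (N000 `&` A),
      exists phi : set ('I_m + 'I_n -> Ms) -> set ('I_m + 'I_n -> Ms),
        quotient_isomorphism op N00 N000 (N00 `&` A) (N000 `&` A) phi /\
        invariant_coset_map b op N00 N000 phi
    & quotient_abelian op N00 N000].
Proof.
move=> b A op Bfin FD gG0 gA0 ac0 co0 _ _ mon FDs G00P G000P N00P N000P GE.
have [_ el _ _] := mon.
have [gG gA acD coD] := cocycle_transfer el FD FDs gG0 gA0 ac0 co0.
have gE := ext_is_group gG gA acD coD.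
have [e [inv glE]] := group_laws_exist gE.
have [e' [inv' glG]] := group_laws_exist gG.
have ue' : is_unit (gmul Ds) (grp Ds) e'.
  split=> [|y Gy]; first exact: gl_one glG.
  by rewrite (gl_1mul glG) ?(gl_mul1 glG).
have [a0 Aa0] : abg Ds !=set0 by have [[_ _ [z [Az _] _]] _] := gA; exists z.
pose pi (x : 'I_m + 'I_n -> Ms) := x \o inr : 'I_n -> Ms.
have piK x : ext_carrier Ds x -> grp Ds (pi x) by move=> /ext_carrierP[].
have piM x y : ext_carrier Ds x -> ext_carrier Ds y ->
    pi (op x y) = gmul Ds (pi x) (pi y) by [].
have pi_surj y : grp Ds y -> exists2 x, ext_carrier Ds x & pi x = y.
  by move=> Gy; exists (join a0 y) => //; exact/ext_carrierP.
have Einv := ext_carrier_invariant FDs.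
have opinv := ext_mul_invariant FDs gA acD coD.
have nE : normal_subgroup op (ext_carrier Ds) N000.
  apply: comp000_normal mon _ gE Einv opinv N000P.
  by rewrite -(eq_finite_set (card_setT B)) in Bfin.
have [[sN00 N00bd N00td] N00min] := N00P.
have [[sN000 N000bd N000inv] N000min] := N000P.
have [[sG00 G00bd G00td] _] := G00P.
have [_ G000min] := G000P.
have N000N00 : N000 `<=` N00.
  by apply: N000min; split=> //; exact: type_definable_invariant.
(* The two inclusions pi(N00) <= G00 and G000 <= pi(N000). *)
have N00pre : N00 `<=` hom_preimage (ext_carrier Ds) pi G00.
  apply: N00min; split.
  - exact: (subgroup_preimage glE glG piK piM).
  - apply: card_le_small G00bd.
    exact: (card_cosets_preimage glE glG piK piM pi_surj).
  - exact: type_definable_preimage FDs _ G00td.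
have G000im : G000 `<=` pi @` N000.
  apply: G000min; split.
  - exact: (subgroup_image glE glG piK piM).
  - apply: card_le_small N000bd.
    exact: (card_cosets_image piM pi_surj sN000.1).
  - by move=> s sc _ [x Nx <-]; exists (s \o x) => //; exact: N000inv.
have gN00 := subgroup_laws glE sN00.
have nN := normal_subgroup_sub sN00 N000N00 nE.
have sA : subgroup op (ext_carrier Ds) A.
  have -> : A = hom_preimage (ext_carrier Ds) pi [set e'].
    apply/seteqP; split=> x.
      move=> /(ext_abgP _ ue')[Ax xe]; split=> //; apply/ext_carrierP.
      by split=> //; rewrite xe; exact: ue'.1.
    by move=> [/ext_carrierP[Ax Gx] xe]; apply/(ext_abgP _ ue').
  apply: (subgroup_preimage glE glG piK piM).
  have Ge := gl_one glG; apply: (subgroup_of_closed glG) => //.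
  - by move=> _ ->.
  - by move=> _ _ -> ->; exact: gl_1mul glG _ _.
  - move=> _ ->; have := gl_1mul glG (gl_inv glG Ge).
    by rewrite (gl_mulV glG).
have comm x y : A x -> A y -> op x y = op y x by exact: ext_abg_mulC.
have rep x : N00 x ->
    exists2 a, (N00 `&` A) a & lcoset op x N000 = lcoset op a N000.
  move=> Nx; have [Ex Gx] := N00pre _ Nx.
  have [k Nk kx] : (pi @` N000) (pi x) by apply: G000im; rewrite GE.
  have Ek := sN000.1 _ Nk; have Vk := gl_inv glE Ek.
  have N00a : N00 (op x (inv k)).
    apply: (gl_mul gN00) => //.
    by apply: (gl_inv gN00); exact: N000N00.
  have Ea := sN00.1 _ N00a.
  (* x k^-1 lies over the unit of G because x and k have the same image. *)
  exists (op x (inv k)).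
    split=> //; apply/(ext_abgP _ ue').
    split; first by have [] := (ext_carrierP _ _).1 Ea.
    change (pi (op x (inv k)) = e').
    rewrite piM // (hom_inv glE glG piK piM) // kx (gl_mulV glG) //.
    exact: piK.
  apply/esym/(lcoset_eqP glE sN000) => //; exists k => //.
  by rewrite -(gl_mulA glE) // (gl_Vmul glE) // (gl_mul1 glE).
split.
- exact: nN.
- exact: (normal_subgroup_setIA glE).
- exists (setI^~ A); split; first exact: (second_isomorphism glE).
  move=> s sc C _; apply/seteqP; split=> [_ [[x Cx <-] Asx]|_ [x [Cx Ax] <-]].
    exists x => //; split=> //.
    have [s' [s'c sK _]] := automorphism_over_inv sc.
    have -> : x = s' \o (s \o x) by apply/funext => v /=; rewrite sK.
    exact: ext_abg_invariant FDs gG _ s'c _ Asx.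
  by split; [exists x|exact: ext_abg_invariant FDs gG _ sc _ Ax].
- exact: (second_isomorphism_abelian glE sN00 nN comm rep).
Qed.
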